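(* Let $d$ be a homogeneous distance on $\mathbb{H}$ with profile $\phi: K \rightarrow [0,+\infty)$. Assume that the following two conditions hold. First, there are $m>0$ and $\alpha \in (0,\pi/2)$ such that, for a.e. $v\in \operatorname{int}(K)\setminus\{0\}$, we have, for all $w\in \mathbb{R}^2\setminus\{0\}$, $$\measuredangle (v,w) \leq \alpha \ \Rightarrow\ \langle \nabla\phi(v) , w \rangle \leq -m \|v\| \|w\|.$$ Second, there are $\kappa>0$ and $M>0$ such that $\{v\in\mathbb{R}^2 : \|v\|\leq \kappa\} \subset \operatorname{int}(K)$ and $$\|\nabla\phi(v)\| \leq M \|v\|$$ for a.e. $v\in \mathbb{R}^2$ such that $\|v\|\leq \kappa$. Then BCP holds in $(\mathbb{H},d)$.
   Context: The first Heisenberg group $\mathbb{H}$ is $\mathbb{R}^2\times\mathbb{R}$ with group law $(v,z)\cdot(v',z') := (v+v', z+z'+\omega(v,v')/2)$, where $\omega(v,v') := v_1v'_2-v_2v'_1$, and dilations $\delta_t(v,z) := (tv,t^2z)$, $t\ge 0$. A distance $d$ on $\mathbb{H}$ is homogeneous if it is left-invariant ($d(p\cdot q,p\cdot q')=d(q,q')$) and $d(\delta_t(p),\delta_t(q))=t\,d(p,q)$ for all $t>0$. Such a distance induces the Euclidean topology. Profile: let $B:=\{p\in\mathbb{H}: d(0,p)\le 1\}$ be the closed unit ball of a homogeneous distance $d$ centered at the origin, $\pi(v,z):=v$ and $K:=\pi(B)$. It is known that $K\subset\mathbb{R}^2$ is compact, convex, $K=-K$, $0\in\operatorname{int}(K)$,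 and that there is a (unique) bounded function $\phi:K\to[0,+\infty)$, locally Lipschitz on $\operatorname{int}(K)$, such that $B=\{(v,z)\in\mathbb{H}: v\in K,\ -\phi(-v)\le z\le\phi(v)\}$. This $\phi$ is called the profile of $d$. $\langle\cdot,\cdot\rangle$ and $\|\cdot\|$ are the Euclidean scalar product and norm; $\measuredangle(v,w):=\arccos\frac{\langle v,w\rangle}{\|v\|\|w\|}\in[0,\pi]$ is the unoriented angle between nonzero vectors. ''A.e.'' refers to Lebesgue measure. BCP: in a metric space, balls are closed balls $B(p,r)=\{q: d(p,q)\le r\}$, $0<r<\infty$ (a ball comes with its center and radius). A family $\mathcal{B}$ of balls is a Besicovitch family if the center of each $B\in\mathcal{B}$ belongs to no other $B'\in\mathcal{B}$, $B'\ne B$, and $\bigcap_{B\in\mathcal{B}}B\neq\emptyset$. The space satisfies the Besicovitch Covering Property (BCP) if there is a constant $C\ge1$ such that $\operatorname{Card}\mathcal{B}\le C$ for every Besicovitch family $\mathcal{B}$ of balls. *)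

(* Defs.v *)
From mathcomp Require Import all_boot all_order all_algebra.
From mathcomp Require Import all_classical all_reals all_analysis.
Set Implicit Arguments.
Unset Strict Implicit.
Unset Printing Implicit Defensive.
Import Order.TTheory GRing.Theory Num.Theory.
Import numFieldNormedType.Exports.
Local Open Scope classical_set_scope.
Local Open Scope ring_scope.

(* The library norm `|v| on R * R is the sup norm, hence the Euclidean
   structure below. Both norms induce the same topology, so the library's
   interior, neighbourhoods and differentiability on R * R are the usual ones. *)
Definition edot (R : realType) (v w : R * R) : R := v.1 * w.1 + v.2 * w.2.

Definition enorm (R : realType) (v : R * R) : R := Num.sqrt (edot v v).

Definition angle (R : realType) (v w : R * R) : R :=
  acos (edot v w / (enorm v * enorm w)).

(* Meaningful where f is differentiable. *)
Definition grad (R : realType) (f : R * R -> R) (v : R * R) : R * R :=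
  ('D_((1, 0) : R * R) f v, 'D_((0, 1) : R * R) f v).

Definition lebesgue2 (R : realType) :
    {measure set (measurableTypeR R * measurableTypeR R) -> \bar R} :=
  (@lebesgue_measure R \x @lebesgue_measure R)%E.
Arguments lebesgue2 R : clear implicits.

Definition heis (R : realType) : Type := ((R * R) * R)%type.

Definition heis0 (R : realType) : heis R := ((0, 0), 0).

Definition omega (R : realType) (v w : R * R) : R := v.1 * w.2 - v.2 * w.1.

Definition heis_mul (R : realType) (p q : heis R) : heis R :=
  (p.1 + q.1, p.2 + q.2 + omega p.1 q.1 / 2).

Definition heis_dil (R : realType) (t : R) (p : heis R) : heis R :=
  ((t * p.1.1, t * p.1.2), t ^+ 2 * p.2).

Definition is_distance (R : realType) (T : Type) (d : T -> T -> R) : Prop :=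
  [/\ forall p q, 0 <= d p q,
      forall p q, d p q = 0 <-> p = q,
      forall p q, d p q = d q p &
      forall p q r, d p r <= d p q + d q r].

Definition homogeneous_distance (R : realType) (d : heis R -> heis R -> R) :
    Prop :=
  [/\ is_distance d,
      forall p q q', d (heis_mul p q) (heis_mul p q') = d q q' &
      forall (t : R) p q, 0 < t -> d (heis_dil t p) (heis_dil t q) = t * d p q].

Definition cball (R : realType) (T : Type) (d : T -> T -> R) (p : T) (r : R) :
    set T :=
  [set q | d p q <= r].

Definition unit_ball (R : realType) (d : heis R -> heis R -> R) :
    set (heis R) :=
  cball d (heis0 R) 1.

Definition ball_proj (R : realType) (d : heis R -> heis R -> R) :
    set (R * R) :=
  [set p.1 | p in unit_ball d].

Definition locally_lipschitz (R : realType) (A : set (R * R))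
    (f : R * R -> R) : Prop :=
  forall v, A v -> exists2 U, nbhs v U & [lipschitz f u | u in U].

(* phi is a total function of which only the values on K := ball_proj d
   matter. *)
Definition is_profile (R : realType) (d : heis R -> heis R -> R)
    (phi : R * R -> R) : Prop :=
  let K := ball_proj d in
  [/\ forall v, K v -> 0 <= phi v,
      exists C : R, forall v, K v -> phi v <= C,
      locally_lipschitz K° phi &
      unit_ball d = [set p | K p.1 /\ - phi (- p.1) <= p.2 <= phi p.1]].

(* A ball comes with its center and radius, so a family of balls is a set of
   pairs (center, radius). *)
Definition besicovitch_family (R : realType) (T : Type) (d : T -> T -> R)
    (F : set (T * R)) : Prop :=
  [/\ forall b, F b -> 0 < b.2,
      forall b b', F b -> F b' -> b' <> b -> ~ cball d b'.1 b'.2 b.1 &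
      \bigcap_(b in F) cball d b.1 b.2 !=set0].

Definition BCP (R : realType) (T : Type) (d : T -> T -> R) : Prop :=
  exists2 C : nat, (1 <= C)%N &
    forall F : set (T * R), besicovitch_family d F -> (F #<= `I_C)%card.

(* Main.v *)
(* Translating a common point of a Besicovitch family to the origin, the centers
   p satisfy d(p, q) > max(N p, N q) for p <> q, where N = d(0, .). It
   therefore suffices to colour H \ {0} with finitely many colours so that
   d(p, q) <= max(N p, N q) whenever p and q have the same colour.

   The colour of p = (v, z) records the approximate direction of v, the sign of
   z, whether |z| >= Lam |v|^2, the parity of the scale k of p (N p is about
   eps^(-k)), and the approximate position of p after rescaling by eps^k. Points
   of the same scale and colour are close after rescaling. Otherwise one point
   q = (w, t) is much smaller than p, and after normalizing N p = 1 the claim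
   p^-1 q \in B amounts to z - t + omega(v, w)/2 <= phi(v - w) and its mirror
   image, given z <= phi(v). If |z| < Lam |v|^2, then |v| is bounded below, and
   the cone condition gives phi(v - w) >= phi(v) + (m/2) |v| |w|, which absorbs
   both omega(v, w) and t = O(|w|^2). If |z| >= Lam |v|^2, then v is small and t
   has the sign of z; the cone condition again suffices when |w| is small with
   respect to |v|, and otherwise phi(v) - phi(v - w) = O(|w|^2) <= t by the
   second condition.

   The a.e. gradient bounds are integrated along almost every segment by
   Fubini, then along every segment by continuity. *)
Require Import Defs.
From mathcomp Require Import all_boot all_order all_algebra.
From mathcomp Require Import all_classical all_reals all_analysis.
From mathcomp Require Import measurable_realfun zify ring lra.
Import Order.TTheory GRing.Theory Num.Theory.
Import numFieldNormedType.Exports.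
Local Open Scope classical_set_scope.
Local Open Scope ring_scope.
Set Implicit Arguments.
Unset Strict Implicit.
Unset Printing Implicit Defensive.

(** * Integrating almost everywhere derivative bounds *)

(** [S] collects the [t] such that [P] holds on all of [[a, t]]. The left condition puts [sup S] in
    [S], and the right condition excludes [sup S < b]. *)
Lemma real_induction (R : realType) (a b : R) (P : R -> Prop) : a <= b ->
  P a ->
  (forall t, a <= t < b -> P t ->
    exists2 e, 0 < e & forall s, t < s < t + e -> s <= b -> P s) ->
  (forall t, a < t <= b -> (forall s, a <= s < t -> P s) -> P t) ->
  P b.
Proof.
move=> ab Pa Pright Pleft.
pose S := [set t | a <= t <= b /\ forall s, a <= s <= t -> P s].
have Sa : S a.
  by split=> [|s /andP[sa as_]]; [rewrite lexx|have -> : s = a by lra].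
have ubS : ubound S b by move=> t [/andP[]].
have supS : has_sup S by split; [exists a|exists b].
have am : a <= sup S by apply: ub_le_sup => //; exists b.
have mb : sup S <= b by apply: sup_le_ub => //; exists a.
have Plt s : a <= s < sup S -> P s.
  move=> /andP[sa sm].
  have [t [_ Pt] st] := sup_gt (ex_intro _ a Sa) sm.
  by apply: Pt; rewrite sa ltW.
have Pm : P (sup S).
  have [am'|ma] := ltP a (sup S); last by have -> : sup S = a by lra.
  by apply: Pleft => //; rewrite am'.
have [mb'|bm] := ltP (sup S) b; last by have <- : sup S = b by lra.
have [e e0 Pe] := Pright _ (introT andP (conj am mb')) Pm.
pose s := Num.min b (sup S + e / 2).
have sm : sup S < s by rewrite lt_min mb' ltrDl divr_gt0.
have sb : s <= b by rewrite ge_min lexx.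
have se : s <= sup S + e / 2 by rewrite ge_min lexx orbT.
suff /(ub_le_sup (ex_intro _ b ubS)) : S s by lra.
split=> [|t /andP[at_ ts]]; first lra.
have [tm|mt|->//] := ltgtP t (sup S); first by apply: Plt; lra.
by apply: Pe; lra.
Qed.

(** Real induction glues the local bounds, in place of a compactness argument on [[a, b]]. *)
Lemma growth_of_local_growth (R : realType) (a b c : R) (g : R -> R) : a <= b ->
  (forall t, a <= t <= b -> exists2 e, 0 < e & forall s1 s2,
    a <= s1 -> s1 <= s2 -> s2 <= b -> t - e < s1 -> s2 < t + e ->
    g s2 - g s1 <= c * (s2 - s1)) ->
  g b - g a <= c * (b - a).
Proof.
move=> ab locg.
apply: (@real_induction R a b (fun t => g t - g a <= c * (t - a))) => //.
- by rewrite !subrr mulr0.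
- move=> t /andP[at_ tb] gt.
  have [|e e0 ge] := locg t; first by rewrite at_ ltW.
  exists e => // s /andP[ts se] sb.
  by have := ge t s; lra.
- move=> t /andP[at_ tb] glt.
  have [|e e0 ge] := locg t; first by rewrite ltW.
  pose s := Num.max a (t - e / 2).
  have sa : a <= s by rewrite le_max lexx.
  have se : t - e / 2 <= s by rewrite le_max lexx orbT.
  have st : s < t by rewrite gt_max at_ gtrBl divr_gt0.
  by have := ge s t; have := glt s; lra.
Qed.

Section lipschitz_growth.
Context {R : realType}.
Let mu : {measure set (measurableTypeR R) -> \bar R} := @lebesgue_measure R.

(* The growth of f on the exceptional set is charged to an open set U of small
   measure that contains it. *)
Lemma lipschitz_ae_growth (a b c L : R) (f : R -> R) (E : set R) : a <= b ->
  (forall s t, a <= s <= b -> a <= t <= b -> `|f t - f s| <= L * `|t - s|) ->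
  mu.-negligible E ->
  (forall t, a <= t < b -> ~ E t -> forall e, 0 < e ->
    exists2 r, 0 < r & forall s, t < s < t + r -> s <= b ->
      f s - f t <= (c + e) * (s - t)) ->
  f b - f a <= c * (b - a).
Proof.
move=> ab; rewrite le_eqVlt in ab; case/orP: ab => [/eqP <-|ab].
  by rewrite !subrr mulr0.
move=> lipf [A [mA A0 EA]] fE.
have L0 : 0 <= L.
  have := lipf a b; rewrite !lexx (ltW ab) => /(_ isT isT).
  move=> /(le_trans (normr_ge0 _)).
  by rewrite pmulr_lge0// normr_gt0 subr_eq0 gt_eqF.
(* Inside [U] only the Lipschitz bound is available. It exceeds the slope [c] by at most [K], and
   the excess is paid by [K] times the measure of [U]. *)
pose K := L + `|c|.
have K0 : 0 <= K by rewrite addr_ge0.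
suff H e : 0 < e -> f b - f a <= (c + e) * (b - a) + K * e.
  apply/ler_addgt0Pr => e e0; pose D := b - a + K.
  have D0 : 0 < D by rewrite /D; lra.
  apply: le_trans (H (e / D) (divr_gt0 e0 D0)) _.
  by rewrite mulrDl -addrA lerD2l mulrC -mulrDl -/D mulrC divfK ?gt_eqF.
move=> e0.
have Aoo : (mu A < +oo)%E by rewrite A0 ltry.
have [U [oU AU muU]] := lebesgue_regularity_outer mA Aoo e0.
have mU : measurable U by exact: open_measurable.
have {}muU : (mu U < e%:E)%E.
  rewrite -(setDUK AU).
  apply: le_lt_trans (measureU2 mu mA (measurableD mU mA)) _.
  by rewrite [X in (X + _ < _)%E]A0 add0e.
have mUI t : measurable (U `&` `]a, t]%classic) by exact: measurableI.
have UIU t : (mu (U `&` `]a, t]%classic) <= mu U)%E.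
  by apply: le_measure; rewrite ?inE//; exact: mUI.
have UIfin t : mu (U `&` `]a, t]%classic) \is a fin_num.
  rewrite ge0_fin_numE//; apply: le_lt_trans (UIU t) _.
  by apply: lt_trans muU _; rewrite ltry.
(* The part of the measure of [U] spent up to [t]: monotone, at most [e], and of slope one across
   [U]. *)
pose h t := fine (mu (U `&` `]a, t]%classic)).
have hle t : h t <= e by rewrite -lee_fin fineK//; apply/ltW/le_lt_trans/muU.
have hmono s t : s <= t -> h s <= h t.
  move=> st; apply: fine_le => //.
  apply: le_measure; rewrite ?inE; [exact: mUI..|].
  apply: setIS => x /=; rewrite !in_itv/= => /andP[-> xs].
  exact: le_trans xs st.
have hU s t : a <= s -> s <= t -> `]s, t] `<=` U -> h s + (t - s) <= h t.
  move=> as_ st stU; rewrite -lee_fin EFinD !fineK//.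
  have -> : (t - s)%:E = mu `]s, t]%classic.
    apply/esym; apply: etrans (lebesgue_measure_itv `]s, t]) _.
    rewrite /= lte_fin.
    have [_|ts] := ltP s t; first by rewrite EFinB.
    by rewrite (_ : t = s) ?subrr//; apply/eqP; rewrite eq_le ts.
  rewrite -measureU//.
    apply: le_measure; rewrite ?inE; [|exact: mUI|].
      by apply: measurableU => //; exact: mUI.
    rewrite subUset; split=> x /=; rewrite !in_itv/=.
      by case=> Ux /andP[ax xs]; split=> //; rewrite ax (le_trans xs).
    move=> xst; split; first by apply: stU; rewrite /= in_itv.
    by case/andP: xst => sx ->; rewrite (le_lt_trans as_).
    exact: mUI.
  by rewrite -subset0 => x /= [[_]]; rewrite !in_itv/=; lra.
suff : f b - f a <= (c + e) * (b - a) + K * h b.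
  by move/le_trans; apply; rewrite lerD2l ler_wpM2l.
apply: (@real_induction R a b
  (fun t => f t - f a <= (c + e) * (t - a) + K * h t)); first exact: ltW.
- by rewrite !subrr mulr0 add0r mulr_ge0// fine_ge0.
- move=> t /andP[at_ tb] Pt.
  have [Ut|nUt] := pselect (U t).
    have /nbhs_ballP[r /= r0 rU] : nbhs t U by exact: open_nbhs_nbhs.
    exists r => // s /andP[ts sr] sb.
    have hs : h t + (s - t) <= h s.
      apply: hU => //; first exact: ltW.
      move=> x /=; rewrite in_itv/= => tx; apply: rU.
      by rewrite /ball/= distrC ger0_norm; lra.
    have /ler_normlW fst : `|f s - f t| <= L * `|s - t| by apply: lipf; lra.
    rewrite ger0_norm in fst; last lra.
    have : K * (h t + (s - t)) <= K * h s by rewrite ler_wpM2l.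
    have : - c * (s - t) <= `|c| * (s - t).
      by rewrite ler_wpM2r ?subr_ge0 ?(ltW ts)// -normrN ler_norm.
    have : 0 <= e * (s - t) by rewrite mulr_ge0; lra.
    have : K * (s - t) = L * (s - t) + `|c| * (s - t) by rewrite mulrDl.
    lra.
  have [||r r0 rf] := fE t _ _ _ e0; first by rewrite at_.
    by move/EA/AU.
  exists r => // s ts sb; have := rf s ts sb.
  have : K * h t <= K * h s by rewrite ler_wpM2l// hmono//; lra.
  lra.
- move=> t /andP[at_ tb] Plt.
  (* Suppose the bound fails by [eta] at [t]. Since [h] is monotone, going back to [s] within
     [eta / Q] of [t] lowers the gap by less than [eta], so the bound would already fail at [s]. *)
  rewrite leNgt; apply/negP; set B := (X in X < _) => tB.
  pose eta := f t - f a - B; have eta0 : 0 < eta by rewrite /eta subr_gt0.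
  pose Q := L + `|c| + e + 1; have Q0 : 0 < Q.
    by rewrite /Q; have := normr_ge0 c; lra.
  pose s := Num.max a (t - eta / Q).
  have as_ : a <= s by rewrite le_max lexx.
  have se : t - eta / Q <= s by rewrite le_max lexx orbT.
  have st : s < t by rewrite gt_max at_ gtrBl divr_gt0.
  have Ps : f s - f a <= (c + e) * (s - a) + K * h s by apply: Plt; rewrite as_.
  have /ler_normlW fst : `|f t - f s| <= L * `|t - s| by apply: lipf; lra.
  rewrite ger0_norm in fst; last lra.
  have Kh : K * h s <= K * h t by rewrite ler_wpM2l// hmono// ltW.
  have : - c * (t - s) <= `|c| * (t - s).
    by rewrite ler_wpM2r ?subr_ge0 ?(ltW st)// -normrN ler_norm.
  have : Q * (t - s) <= eta.
    by rewrite mulrC -ler_pdivlMr//; lra.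
  have : 0 <= e * (t - s) by rewrite mulr_ge0; lra.
  by rewrite /Q /eta /B; lra.
Qed.

End lipschitz_growth.

(** * Null sets of the plane along parallel lines *)

Section null_sections.
Context {R : realType}.
Let mu : {measure set (measurableTypeR R) -> \bar R} := @lebesgue_measure R.

Let affine (a b : R) : measurableTypeR R -> measurableTypeR R :=
  fun t => a * t + b.

Let measurable_affine a b : measurable_fun setT (affine a b).
Proof. by apply: measurable_funD => //; apply: measurable_funM. Qed.

(** Lebesgue measure is determined by its values on the intervals []x, y]], so it is compared there
    with [|a|] times the image measure; a negative [a] reverses the preimage. *)
Let lebesgue_measure_affine (a b : R) (A : set (measurableTypeR R)) : a != 0 ->
  measurable A -> mu A = (`|a|%:E * mu (affine a b @^-1` A))%E.
Proof.
move=> a0 mA.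
have mf := measurable_affine a b.
pose nu0 : {measure set (measurableTypeR R) -> \bar R} :=
  mscale (NngNum (normr_ge0 a)) (pushforward mu (affine a b)).
pose nu := nu0 mf.
suff : @lebesgue_measure R A = nu A by [].
apply: lebesgue_measure_unique => // _ [[x y] _ <-].
rewrite -[RHS]/(`|a|%:E * mu (affine a b @^-1` `]x, y]%classic))%E.
rewrite -[LHS]/(mu `]x, y]%classic).
have [xy|yx] := ltP x y; last first.
  by rewrite set_itv_ge ?bnd_simp -?leNgt// preimage_set0 !measure0 mule0.
apply: etrans (lebesgue_measure_itv `]x, y]) _; rewrite /= lte_fin xy.
have [ap|an] := ltP 0 a.
  have -> : affine a b @^-1` `]x, y] = `](x - b) / a, (y - b) / a]%classic.
    apply/seteqP; split=> t; rewrite /affine /= !in_itv/=;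
    by rewrite ltr_pdivrMr// ler_pdivlMr// ltrBlDr lerBrDr mulrC.
  rewrite [X in (_ * X)%E](_ : _ = ((y - b) / a - (x - b) / a)%:E).
    by rewrite -EFinM -EFinB gtr0_norm//; congr EFin; field.
  apply: etrans (lebesgue_measure_itv _) _.
  by rewrite /= lte_fin ltr_pM2r ?invr_gt0// ltrD2r xy EFinB.
have {}an : a < 0 by rewrite lt_neqAle a0.
have -> : affine a b @^-1` `]x, y] = `[(y - b) / a, (x - b) / a[%classic.
  apply/seteqP; split=> t; rewrite /affine /= !in_itv/=;
  by rewrite ltr_ndivlMr// ler_ndivrMr// ltrBlDr lerBrDr mulrC andbC.
rewrite [X in (_ * X)%E](_ : _ = ((x - b) / a - (y - b) / a)%:E).
  by rewrite -EFinM -EFinB ltr0_norm//; congr EFin; field.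
apply: etrans (lebesgue_measure_itv _) _.
by rewrite /= lte_fin ltr_nM2r ?invr_lt0// ltrD2r xy EFinB.
Qed.

Lemma negligible_affine (a b : R) (E : set R) : a != 0 ->
  mu.-negligible E -> mu.-negligible [set t | E (a * t + b)].
Proof.
move=> a0 [A [mA A0 EA]]; exists (affine a b @^-1` A).
have mA' : measurable (affine a b @^-1` A).
  by rewrite -[X in measurable X]setTI; exact: measurable_affine.
split=> // [|t /EA //].
have := lebesgue_measure_affine b a0 mA; rewrite A0 => /esym/eqP.
by rewrite mule_eq0 eqe normr_eq0 (negPf a0) => /eqP.
Qed.

Lemma negligible_ex_near0 (E : set R) (e : R) : 0 < e -> mu.-negligible E ->
  exists2 y, `|y| < e & ~ E y.
Proof.
move=> e0 [A [mA A0 EA]]; apply: contrapT => H.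
have eA : `]0, e[ `<=` A.
  move=> y; rewrite /= in_itv/= => /andP[y0 ye].
  apply: EA; apply: contrapT => nEy; apply: H; exists y => //.
  by rewrite gtr0_norm.
have mu0e : mu `]0, e[%classic = e%:E.
  by apply: etrans (lebesgue_measure_itv _) _; rewrite /= lte_fin e0 sube0.
suff : (e%:E <= 0)%E by rewrite lee_fin leNgt e0.
by rewrite -mu0e -A0; apply: le_measure; rewrite ?inE//; exact: measurable_itv.
Qed.

Lemma negligible_xsection (E : set (R * R)) : (lebesgue2 R).-negligible E ->
  {ae mu, forall x, mu.-negligible [set y | E (x, y)]}.
Proof.
move=> [A [mA A0 EA]].
have mF := measurable_fun_xsection (@lebesgue_measure R) mA.
have : {ae mu, forall x, setT x -> (mu \o xsection A) x = cst 0%E x}.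
  apply/(ae_eq_integral_abs mu measurableT mF).
  (* [A0] fits by conversion: the product measure is the integral of the measures of the vertical
     sections. *)
  by under eq_integral do rewrite gee0_abs//; exact: A0.
apply: filterS => x /= /(_ I) Ax; exists (xsection A x); split => //.
  exact: measurable_xsection.
by move=> y /EA; rewrite xsectionP.
Qed.

(** The shear [(u, y) -> (u, y + a * u)] translates each vertical line, so preimages of null sets
    are null. Tonelli then passes to the horizontal sections of the preimage, which are the lines of
    slope [a]. *)
Lemma negligible_slope_section (a : R) (E : set (R * R)) :
  (lebesgue2 R).-negligible E ->
  {ae mu, forall y, mu.-negligible [set u | E (u, y + a * u)]}.
Proof.
move=> [A [mA A0 EA]].
pose shear (p : measurableTypeR R * measurableTypeR R) :
  measurableTypeR R * measurableTypeR R := (p.1, p.2 + a * p.1).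
have mshear : measurable_fun setT shear.
  apply: measurable_fun_pair => //; apply: measurable_funD => //.
  by apply: measurable_funM => //.
pose B := shear @^-1` A.
have mB : measurable B by rewrite -[X in measurable X]setTI; exact: mshear.
have : (\int[mu]_x (mu \o xsection B) x = 0)%E.
  rewrite (_ : _ \o _ = mu \o xsection A); first exact: A0.
  apply/funext => x /=.
  rewrite (@lebesgue_measure_affine 1 (a * x) (xsection A x)) ?oner_neq0//.
    rewrite normr1 mul1e !xsectionE; congr (mu _); apply/seteqP.
    by split=> y; rewrite /affine /B /shear /= mul1r.
  exact: measurable_xsection.
have -> : (\int[mu]_x (mu \o xsection B) x = \int[mu]_y (mu \o ysection B) y)%E.
  have := @indic_fubini_tonelli _ _ _ _ R (@lebesgue_measure R)
    (@lebesgue_measure R) B mB.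
  by rewrite indic_fubini_tonelli_FE// indic_fubini_tonelli_GE.
move=> intB.
have mG := measurable_fun_ysection (@lebesgue_measure R) mB.
have : {ae mu, forall x, setT x -> (mu \o ysection B) x = cst 0%E x}.
  apply/(ae_eq_integral_abs mu measurableT mG).
  by under eq_integral do rewrite gee0_abs//; exact: intB.
apply: filterS => y /= /(_ I) By; exists (ysection B y); split => //.
  exact: measurable_ysection.
by move=> u /EA; rewrite ysectionP.
Qed.

(** Almost every line parallel to [w] meets [E] in a null set. Such lines are reached by a
    horizontal translation if [w] is vertical, by a vertical one otherwise. *)
Lemma negligible_line (E : set (R * R)) (p w : R * R) (e : R) :
  (lebesgue2 R).-negligible E -> w <> 0 -> 0 < e ->
  exists2 y : R * R, `|y| < e & mu.-negligible [set t | E (p + y + t *: w)].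
Proof.
case: p w => [p1 p2] [w1 w2] E0 w0 e0.
have [w10|w10] := eqVneq w1 0.
  have w20 : w2 != 0 by apply/eqP => w20; apply: w0; rewrite w10 w20.
  have := negligible_affine p1 (oner_neq0 R) (negligible_xsection E0).
  move=> /(negligible_ex_near0 e0)[y ye /= /contrapT Ey].
  exists (y, 0); first by rewrite prod_normE/= normr0 gt_max ye.
  apply: negligibleS (negligible_affine p2 w20 Ey) => t /=.
  by rewrite w10; congr (E _); apply: injective_projections;
    rewrite /= /GRing.scale/=; ring.
have := negligible_affine (p2 - w2 / w1 * p1) (oner_neq0 R)
  (negligible_slope_section (w2 / w1) E0).
move=> /(negligible_ex_near0 e0)[y ye /= /contrapT Ey].
exists (0, y); first by rewrite prod_normE/= normr0 gt_max ye e0.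
apply: negligibleS (negligible_affine p1 w10 Ey) => t /=.
congr (E _); apply: injective_projections; rewrite /= /GRing.scale/=.
  by rewrite addr0; ring.
by field.
Qed.

End null_sections.

(** * From gradient bounds to growth along segments *)

Lemma derive_edot_grad (R : realType) (phi : R * R -> R) (x w : R * R) :
  differentiable phi x -> 'D_w phi x = edot (grad phi x) w.
Proof.
move=> dphi; rewrite /edot /grad /= !deriveE//.
have -> : w = w.1 *: (1, 0) + w.2 *: (0, 1).
  by case: w => w1 w2; apply: injective_projections;
    rewrite /= /GRing.scale/=; ring.
by rewrite linearD !linearZ/= /GRing.scale/=; ring.
Qed.

(** One-sided growth in the form that [lipschitz_ae_growth] requires off the exceptional set. *)
Lemma growth_of_derive (R : realType) (phi : R * R -> R) (x w : R * R)
    (c e : R) :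
  differentiable phi x -> 'D_w phi x <= c -> 0 < e ->
  exists2 r, 0 < r & forall h, 0 < h < r ->
    phi (x + h *: w) - phi x <= (c + e) * h.
Proof.
move=> dphi Dc e0.
have /cvgrPdist_lt/(_ _ e0) : h^-1 *: ((phi \o shift x) (h *: w) - phi x)
    @[h --> 0^'] --> 'D_w phi x.
  exact: diff_derivable.
rewrite near_withinE => /nbhs_norm0P[r /= r0 hr].
exists r => // h /andP[h0 hlt].
have := hr h; rewrite /= gtr0_norm// gt_eqF// => /(_ hlt isT).
rewrite ltr_norml => /andP[+ _]; rewrite [_ *: w + x]addrC.
rewrite /GRing.scale/= => hD.
have : (phi (x + h *: w) - phi x) / h < 'D_w phi x + e by rewrite mulrC; lra.
rewrite ltr_pdivrMr// => /ltW/le_trans; apply.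
by rewrite ler_wpM2r// ?(ltW h0)//; lra.
Qed.

(** The segment itself may lie in the exceptional set. Locally it is moved to a nearby parallel line
    on which the gradient bound holds almost everywhere; the error vanishes with the shift because
    [phi] is locally Lipschitz. *)
Lemma segment_growth (R : realType) (phi : R * R -> R) (V : set (R * R))
    (x w : R * R) (c : R) :
  open V -> locally_lipschitz V phi -> w <> 0 ->
  {ae lebesgue2 R, forall v, V v ->
    differentiable phi v /\ edot (grad phi v) w <= c} ->
  (forall t, 0 <= t <= 1 -> V (x + t *: w)) ->
  phi (x + w) - phi x <= c.
Proof.
move=> oV lipV w0 aeV xV.
suff : phi (x + 1 *: w) - phi (x + 0 *: w) <= c * (1 - 0).
  by rewrite scale1r scale0r addr0 subr0 mulr1.
apply: (@growth_of_local_growth R 0 1 c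
  (fun t => phi (x + t *: w))) => // t t01.
have Vt := xV t t01.
(* The Lipschitz property provides a threshold [k0] above which every constant works, whence some
   [k >= 1]. *)
have [U nU [k0 [_ /(_ (Num.max k0 0 + 1))]]] := lipV _ Vt.
set k := Num.max k0 0 + 1 => /(_ _)/wrap[].
  by rewrite ltr_pwDr// le_max lexx.
move=> kU; have k1 : 1 <= k by rewrite lerDr le_max lexx orbT.
have /nbhs_ballP[r /= r0 rUV] : nbhs (x + t *: w) (U `&` V).
  by apply: filterI => //; exact: open_nbhs_nbhs.
rewrite -ball_normE /ball_/= in rUV.
have {}kU a b : `|x + t *: w - a| < r -> `|x + t *: w - b| < r ->
    `|phi a - phi b| <= k * `|a - b|.
  move=> ar br; apply: (kU (a, b)); split; exact: (rUV _ _).1.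
pose W := `|w| + 1; have W0 : 0 < W by rewrite /W ltr_wpDl.
exists (r / 2 / W); first by rewrite !divr_gt0.
have near_t s : t - r / 2 / W < s -> s < t + r / 2 / W ->
    `|x + t *: w - (x + s *: w)| <= r / 2.
  move=> ts st; rewrite opprD addrACA subrr add0r -scalerBl normrZ.
  have : `|t - s| <= r / 2 / W by rewrite ler_norml; lra.
  rewrite ler_pdivlMr//; apply: le_trans.
  by rewrite ler_wpM2l// /W lerDl.
move=> s1 s2 s10 s12 s21 ts1 s2t.
apply/ler_addgt0Pr => e e0.
(* A shift below [r / 2] stays in the ball where [phi] is [k]-Lipschitz; one below [e / (2 * k)]
   costs at most [e / 2] at each endpoint. *)
pose del := Num.min (r / 2) (e / (2 * k)).
have del0 : 0 < del by rewrite lt_min !divr_gt0//; lra.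
have [y ydel null_y] := negligible_line x aeV w0 del0.
have yr : `|y| < r / 2 by apply: lt_le_trans ydel _; rewrite ge_min lexx.
have ye : k * `|y| <= e / 2.
  rewrite mulrC -ler_pdivlMr; last lra.
  rewrite -mulrA -invfM; apply/ltW/(lt_le_trans ydel).
  by rewrite ge_min lexx orbT.
have near_y s : t - r / 2 / W < s -> s < t + r / 2 / W ->
    `|x + t *: w - (x + y + s *: w)| < r.
  move=> ts st; rewrite [x + y + _]addrAC opprD addrA.
  apply: le_lt_trans (ler_normD _ _) _; rewrite normrN.
  by have := near_t s ts st; lra.
have shift_y s : t - r / 2 / W < s -> s < t + r / 2 / W ->
    `|phi (x + s *: w) - phi (x + y + s *: w)| <= e / 2.
  move=> ts st; apply: le_trans (kU _ _ _ _) _.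
  - by have := near_t s ts st; lra.
  - exact: near_y.
  by rewrite [x + y + _]addrAC opprD addrA subrr add0r normrN.
have : phi (x + y + s2 *: w) - phi (x + y + s1 *: w) <= c * (s2 - s1).
  apply: (@lipschitz_ae_growth R s1 s2 c (k * `|w|)
    (fun s => phi (x + y + s *: w)) _ s12 _ null_y).
  - move=> s s' s_ s'_; apply: le_trans (kU _ _ _ _) _.
    + by apply: near_y; lra.
    + by apply: near_y; lra.
    + by rewrite opprD addrACA subrr add0r -scalerBl normrZ mulrA mulrAC.
  - move=> s /andP[s1s ss2] /= /contrapT Vs d d0.
    have [|dphi Dc] := Vs; first by apply: (rUV _ _).2; apply: near_y; lra.
    rewrite -derive_edot_grad// in Dc.
    have [q q0 qphi] := growth_of_derive dphi Dc d0.
    exists q => // s' /andP[ss' s'q] s's2.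
    have := qphi (s' - s); rewrite -[_ + _ + _ + _]addrA -scalerDl subrKC.
    by apply; lra.
have := shift_y s1; have := shift_y s2.
rewrite !ler_norml; lra.
Qed.

(** * The Euclidean plane *)

Section euclidean_plane.
Context {R : realType}.
Implicit Types v w : R * R.

Lemma enorm_ge0 v : 0 <= enorm v. Proof. exact: sqrtr_ge0. Qed.

Lemma edotvv v : edot v v = enorm v ^+ 2.
Proof. by rewrite sqr_sqrtr// addr_ge0// -expr2 sqr_ge0. Qed.

Lemma enorm_eq0 v : enorm v = 0 -> v = 0.
Proof.
move=> v0; have := edotvv v; rewrite v0 expr0n/= /edot => vv.
have : v.1 ^+ 2 = 0 by have := sqr_ge0 v.1; have := sqr_ge0 v.2; lra.
have : v.2 ^+ 2 = 0 by have := sqr_ge0 v.1; have := sqr_ge0 v.2; lra.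
move=> /eqP + /eqP; rewrite !sqrf_eq0 => /eqP ? /eqP ?.
exact: injective_projections.
Qed.

Lemma enorm0 : enorm (0 : R * R) = 0.
Proof. by rewrite /enorm /edot /= mulr0 addr0 sqrtr0. Qed.

Lemma enorm_gt0 v : v <> 0 -> 0 < enorm v.
Proof. by move=> v0; rewrite lt0r enorm_ge0 andbT; apply/eqP => /enorm_eq0. Qed.

Lemma enormZ (t : R) v : enorm (t *: v) = `|t| * enorm v.
Proof.
rewrite -sqrtr_sqr -sqrtrM ?sqr_ge0//; congr Num.sqrt.
by rewrite /edot /= /GRing.scale/=; ring.
Qed.

Lemma enormN v : enorm (- v) = enorm v.
Proof. by rewrite -scaleN1r enormZ normrN1 mul1r. Qed.

(** Lagrange's identity, the source of the Cauchy-Schwarz bounds for both [edot] and [omega]. *)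
Lemma edot2_omega2 v w :
  edot v w ^+ 2 + omega v w ^+ 2 = (enorm v * enorm w) ^+ 2.
Proof. by rewrite exprMn -!edotvv /edot /omega; ring. Qed.

Lemma edot_le v w : `|edot v w| <= enorm v * enorm w.
Proof.
have E0 : 0 <= enorm v * enorm w by rewrite mulr_ge0 ?enorm_ge0.
rewrite -(ler_pXn2r (n := 2)) ?nnegrE// real_normK ?num_real//.
by rewrite -edot2_omega2 lerDl sqr_ge0.
Qed.

Lemma omega_le v w : `|omega v w| <= enorm v * enorm w.
Proof.
have E0 : 0 <= enorm v * enorm w by rewrite mulr_ge0 ?enorm_ge0.
rewrite -(ler_pXn2r (n := 2)) ?nnegrE// real_normK ?num_real//.
by rewrite -edot2_omega2 lerDr sqr_ge0.
Qed.

Lemma enormD v w : enorm (v + w) <= enorm v + enorm w.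
Proof.
rewrite -(ler_pXn2r (n := 2)) ?nnegrE ?addr_ge0 ?enorm_ge0//.
have -> : enorm (v + w) ^+ 2 = enorm v ^+ 2 + enorm w ^+ 2 + 2 * edot v w.
  by rewrite -!edotvv /edot /=; ring.
by have := ler_norm (edot v w); have := edot_le v w; lra.
Qed.

Lemma enormB v w : enorm (v - w) <= enorm v + enorm w.
Proof. by rewrite -(enormN w); exact: enormD. Qed.

Lemma enorm_le_sum v : enorm v <= `|v.1| + `|v.2|.
Proof.
rewrite -(ler_pXn2r (n := 2)) ?nnegrE ?addr_ge0 ?enorm_ge0// -edotvv /edot.
rewrite sqrrD !real_normK ?num_real// -!expr2.
by have := mulr_ge0 (normr_ge0 v.1) (normr_ge0 v.2); lra.
Qed.

Lemma fst_le_enorm v : `|v.1| <= enorm v.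
Proof.
rewrite -(ler_pXn2r (n := 2)) ?nnegrE ?enorm_ge0// -edotvv /edot.
by rewrite real_normK ?num_real// -!expr2 lerDl sqr_ge0.
Qed.

Lemma snd_le_enorm v : `|v.2| <= enorm v.
Proof.
rewrite -(ler_pXn2r (n := 2)) ?nnegrE ?enorm_ge0// -edotvv /edot.
by rewrite real_normK ?num_real// -!expr2 lerDr sqr_ge0.
Qed.

Lemma edotZr (t : R) v w : edot v (t *: w) = t * edot v w.
Proof. by rewrite /edot /= /GRing.scale/=; ring. Qed.

Lemma edotBl v v' w : edot (v - v') w = edot v w - edot v' w.
Proof. by rewrite /edot /=; ring. Qed.

Lemma omegaZr (t : R) v w : omega v (t *: w) = t * omega v w.
Proof. by rewrite /omega /= /GRing.scale/=; ring. Qed.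

Lemma omegaNN v w : omega (- v) (- w) = omega v w.
Proof. by rewrite /omega /=; ring. Qed.

Lemma continuous_edot w : continuous (fun x : R * R => edot x w).
Proof.
by move=> x; apply: cvgD; apply: cvgMl; [exact: cvg_fst|exact: cvg_snd].
Qed.

Lemma continuous_enorm : continuous (@enorm R).
Proof.
move=> x; apply: continuous_comp; last exact: sqrt_continuous.
by apply: cvgD; apply: cvgM; [exact: cvg_fst..|exact: cvg_snd|exact: cvg_snd].
Qed.

Lemma nbhs_enorm_ball v (e : R) : 0 < e -> nbhs v [set x | enorm (x - v) < e].
Proof.
move=> e0; apply/nbhs_ballP; exists (e / 2); first by rewrite /= divr_gt0.
move=> x; rewrite -ball_normE /ball_/= distrC prod_normE gt_max => /andP[x1 x2].
by apply: le_lt_trans (enorm_le_sum _) _; lra.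
Qed.

(** The unit vectors along [v] and [w] are within [s] of each other. Clearing denominators makes
    this true when [v] or [w] is 0. *)
Definition almost_parallel (s : R) v w :=
  enorm (enorm w *: v - enorm v *: w) <= s * (enorm v * enorm w).

Lemma almost_parallelNN s v w :
  almost_parallel s v w -> almost_parallel s (- v) (- w).
Proof. by rewrite /almost_parallel !enormN !scalerN -opprD enormN. Qed.


(** With [P = |v| |w|], the squared norm in [almost_parallel] is [2 P (P - <v, w>)], so
    [P - <v, w> <= s^2 P / 2]. *)
Lemma almost_parallel_edot s v w : 0 <= s <= 1 -> v <> 0 -> w <> 0 ->
  almost_parallel s v w -> (1 - s) * (enorm v * enorm w) <= edot v w.
Proof.
move=> /andP[s0 s1] /enorm_gt0 v0 /enorm_gt0 w0.
set P := enorm v * enorm w; have P0 : 0 < P by rewrite mulr_gt0.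
rewrite /almost_parallel -(ler_pXn2r (n := 2)) ?nnegrE ?enorm_ge0//; last first.
  by rewrite mulr_ge0// ltW.
have -> : enorm (enorm w *: v - enorm v *: w) ^+ 2 = 2 * P * (P - edot v w).
  rewrite -edotvv /edot /= /GRing.scale/=.
  transitivity (enorm w ^+ 2 * edot v v + enorm v ^+ 2 * edot w w
    - 2 * P * edot v w).
    by rewrite /edot /P; ring.
  by rewrite !edotvv /edot /P; ring.
have -> : (s * P) ^+ 2 = 2 * P * (s ^+ 2 / 2 * P) by field.
rewrite ler_pM2l ?mulr_gt0// => H.
have : s ^+ 2 * P <= s * P by rewrite ler_wpM2r ?(ltW P0)// expr2 ler_piMr.
have : 0 <= s * P by rewrite mulr_ge0// ltW.
lra.
Qed.

(** As [omega v v = 0], up to sign [|v| omega v w] is [omega] of [v] and the small vector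
    [|w| v - |v| w]. *)
Lemma almost_parallel_omega s v w : almost_parallel s v w ->
  `|omega v w| <= s * (enorm v * enorm w).
Proof.
have [->|/eqP v0] := eqVneq v 0.
  by rewrite /omega /= !mul0r subrr normr0 enorm0 !mul0r mulr0.
have {}v0 := enorm_gt0 v0.
move=> vw; rewrite -(ler_pM2l v0).
have -> : enorm v * `|omega v w| = `|omega v (enorm w *: v - enorm v *: w)|.
  rewrite -[X in X * _](ger0_norm (enorm_ge0 v)) -normrM -normrN; congr `|_|.
  by rewrite /omega /= /GRing.scale/=; ring.
by apply: le_trans (omega_le _ _) _; rewrite ler_pM2l.
Qed.

End euclidean_plane.

(** * Homogeneous distances and their profiles *)

Section homogeneous_distance.
Context {R : realType} (d : heis R -> heis R -> R).
Hypothesis hd : homogeneous_distance d.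

Definition heis_inv (p : heis R) : heis R := (- p.1, - p.2).

Local Notation N := (d (heis0 R)).

Lemma heis_invK (p q : heis R) : heis_mul p (heis_mul (heis_inv p) q) = q.
Proof.
case: p q => [[p1 p2] p3] [[q1 q2] q3].
rewrite /heis_mul /heis_inv /omega /=.
by congr pair; [congr pair|]; rewrite /=; field.
Qed.

Lemma dist_heis_inv (p q : heis R) : d p q = N (heis_mul (heis_inv p) q).
Proof.
have [_ dl _] := hd; rewrite -[in LHS](heis_invK p q).
have {1}-> : p = heis_mul p (heis0 R); last exact: dl.
case: p => [[p1 p2] p3]; rewrite /heis_mul /heis0 /omega /=.
by congr pair; [congr pair|]; rewrite /=; field.
Qed.

Lemma hnorm_mul p q : N (heis_mul p q) <= N p + N q.
Proof.
have [[_ _ _ tri] dl _] := hd; apply: le_trans (tri _ p _) _.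
rewrite lerD2l [leLHS](_ : _ = N q)//.
rewrite dist_heis_inv; congr (N _).
have {2}-> : p = heis_inv (heis_inv p).
  by case: p => p1 p2; rewrite /heis_inv/= !opprK.
exact: heis_invK.
Qed.

Lemma hnorm_inv p : N (heis_inv p) = N p.
Proof.
have [[_ _ sym _] _ _] := hd; rewrite -[RHS]sym [RHS]dist_heis_inv; congr (N _).
case: p => [[p1 p2] p3]; rewrite /heis_mul /heis0 /heis_inv /omega /=.
by congr pair; [congr pair|]; rewrite /=; field.
Qed.

Lemma hnorm_dil (t : R) (p : heis R) : 0 < t -> N (heis_dil t p) = t * N p.
Proof.
have [_ _ dil] := hd => t0; rewrite -dil//; congr (d _ _).
by rewrite /heis_dil /heis0 /= !mulr0.
Qed.

Lemma heis_dilK (t : R) (p : heis R) : 0 < t ->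
  heis_dil t (heis_dil t^-1 p) = p.
Proof.
move=> t0; case: p => [[p1 p2] p3]; rewrite /heis_dil /= exprVn.
by rewrite !mulVKf// ?expf_neq0// gt_eqF.
Qed.

Context (phi : R * R -> R).
Hypothesis hphi : is_profile d phi.

Local Notation K := (ball_proj d).

Lemma unit_ballP p : N p <= 1 <-> K p.1 /\ - phi (- p.1) <= p.2 <= phi p.1.
Proof.
by have [_ _ _ B] := hphi; have /seteqP[le ge] := B; split=> [/le|/ge].
Qed.

Lemma ball_projN v : K v -> K (- v).
Proof.
move=> [p Bp <-]; exists (heis_inv p) => //.
by rewrite /unit_ball /cball /= hnorm_inv.
Qed.

Lemma profile_ge0 v : K v -> 0 <= phi v.
Proof. by have [phi0 _ _ _] := hphi; exact: phi0. Qed.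

Lemma profile_top v : K v -> N (v, phi v) <= 1.
Proof.
move=> Kv; apply/unit_ballP; split=> //=; rewrite lexx andbT.
by have := profile_ge0 Kv; have := profile_ge0 (ball_projN Kv); lra.
Qed.

(* The point over (1 - t) v + t u is the product of the dilates by 1 - t and t
   of the top points of B over v and u. *)
Lemma profile_segment v u (t : R) : K v -> K u -> 0 < t < 1 ->
  K ((1 - t) *: v + t *: u) /\
  (1 - t) ^+ 2 * phi v + t ^+ 2 * phi u + t * (1 - t) * omega v u / 2 <=
    phi ((1 - t) *: v + t *: u).
Proof.
move=> Kv Ku /andP[t0 t1]; have t1' : 0 < 1 - t by lra.
have : N (heis_mul (heis_dil (1 - t) (v, phi v)) (heis_dil t (u, phi u))) <= 1.
  apply: le_trans (hnorm_mul _ _) _; rewrite !hnorm_dil//.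
  have : (1 - t) * N (v, phi v) <= (1 - t) * 1 by rewrite ler_pM2l ?profile_top.
  have : t * N (u, phi u) <= t * 1 by rewrite ler_pM2l ?profile_top.
  lra.
move=> /unit_ballP[Kvu /andP[_]].
rewrite /heis_mul /heis_dil /= => ple; split=> //.
apply: le_trans ple; rewrite le_eqVlt; apply/orP; left; apply/eqP.
by rewrite /omega /=; field.
Qed.

(** Turn [v] by a right angle and scale it to length [k] to get [u]. Then [omega v u = k |v|], so
    the profile at the midpoint of [v] and [u] is at least [k |v| / 8], and a bound on [phi] bounds
    [|v|]. *)
Lemma ball_proj_bounded (k : R) : 0 < k -> [set v | enorm v <= k] `<=` K ->
  exists2 C, 1 <= C & forall v, K v -> enorm v <= C /\ phi v <= C.
Proof.
move=> k0 kK; have [_ [C0 phiC] _ _] := hphi.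
pose C := Num.max 1 (Num.max C0 (8 * C0 / k)).
have C0C : C0 <= C by rewrite !le_max lexx orbT.
have kC : 8 * C0 / k <= C by rewrite !le_max lexx !orbT.
exists C => [|v Kv]; first by rewrite le_max lexx.
split; last exact: le_trans (phiC _ Kv) C0C.
have [->|/eqP v0] := eqVneq v 0.
  by rewrite enorm0 le_max ler01.
have {}v0 := enorm_gt0 v0.
apply: le_trans kC; rewrite ler_pdivlMr//.
pose u := (k / enorm v) *: ((- v.2, v.1) : R * R).
have Ku : K u.
  apply: kK; rewrite /= enormZ.
  have -> : enorm (- v.2, v.1) = enorm v.
    by rewrite /enorm; congr Num.sqrt; rewrite /edot /=; ring.
  by rewrite ger0_norm ?divfK ?gt_eqF// divr_ge0 ?ltW.
have h01 : 0 < (1 / 2 : R) < 1 by lra.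
have [Kvu] := profile_segment Kv Ku h01.
have := phiC _ Kvu; set y := phi _ => yC.
have -> : omega v u = k * enorm v.
  rewrite /u omegaZr; have -> : omega v (- v.2, v.1) = enorm v ^+ 2.
    by rewrite -edotvv /omega /edot /=; ring.
  by field; rewrite gt_eqF.
have := profile_ge0 Kv; have := profile_ge0 Ku.
lra.
Qed.

(** Two midpoints in [profile_segment]. The [omega] term gives [phi y >= k^2 / 8] at the midpoint
    [y] of [u1] and [u2]. A small [v] is the midpoint of [y] and [u], and the loss from [omega y u]
    is smaller than the gain [phi y / 4]. *)
Lemma profile_lower_bound (k : R) : 0 < k -> [set v | enorm v <= k] `<=` K ->
  forall v, enorm v <= k / 16 -> k ^+ 2 / 64 <= phi v.
Proof.
move=> k0 kK v vk.
pose u1 : R * R := (k, 0); pose u2 : R * R := (0, k).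
have Ku1 : K u1.
  apply: kK => /=; rewrite (le_trans (enorm_le_sum _))//=.
  by rewrite normr0 addr0 gtr0_norm.
have Ku2 : K u2.
  apply: kK => /=; rewrite (le_trans (enorm_le_sum _))//=.
  by rewrite normr0 add0r gtr0_norm.
have h01 : 0 < (1 / 2 : R) < 1 by lra.
have [] := profile_segment Ku1 Ku2 h01.
set y := (_ + _ : R * R) => Ky.
have -> : omega u1 u2 = k ^+ 2 by rewrite /omega /=; ring.
move=> phiy.
have yE : y = (k / 2, k / 2).
  by apply: injective_projections; rewrite /= /GRing.scale/=; field.
have yk : enorm y <= 3 / 4 * k.
  rewrite -(ler_pXn2r (n := 2)) ?nnegrE ?enorm_ge0//; last lra.
  rewrite -edotvv yE /edot /=.
  by have := sqr_ge0 k; lra.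
pose u : R * R := 2 *: v - y.
have Ku : K u.
  apply: kK => /=; apply: le_trans (enormB _ _) _.
  by rewrite enormZ ger0_norm//; lra.
have [_] := profile_segment Ky Ku h01.
have -> : (1 - 1 / 2) *: y + (1 / 2) *: u = v.
  by apply: injective_projections; rewrite /= /GRing.scale/=; field.
have -> : omega y u = 2 * omega y v.
  by rewrite /omega /= /GRing.scale/=; ring.
have /ler_normlP[om _] := omega_le y v.
have : enorm y * enorm v <= 3 / 4 * k * (k / 16).
  by apply: ler_pM => //; exact: enorm_ge0.
have := profile_ge0 Ku1; have := profile_ge0 Ku2; have := profile_ge0 Ku.
have := profile_ge0 Ky.
have := sqr_ge0 k.
lra.
Qed.

(** By [profile_lower_bound] over a vector and its opposite, the unit ball contains a box; dilations
    give the other radii. *)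
Lemma hnorm_le_of_box (k : R) : 0 < k -> [set v | enorm v <= k] `<=` K ->
  forall (r : R) p, 0 < r -> enorm p.1 <= k / 16 * r ->
    `|p.2| <= (k / 16 * r) ^+ 2 -> N p <= r.
Proof.
move=> k0 kK r p r0 pk pz.
rewrite -(heis_dilK p r0) hnorm_dil// -[leRHS]mulr1 ler_pM2l//.
have p1 : enorm (heis_dil r^-1 p).1 <= k / 16.
  rewrite [X in enorm X](_ : _ = r^-1 *: p.1)//.
  by rewrite enormZ gtr0_norm ?invr_gt0// mulrC ler_pdivrMr.
have p2 : `|(heis_dil r^-1 p).2| <= k ^+ 2 / 64.
  rewrite /= normrM exprVn ger0_norm ?invr_ge0 ?sqr_ge0//.
  rewrite mulrC ler_pdivrMr ?exprn_gt0//; apply: le_trans pz _.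
  by rewrite exprMn ler_pM2r ?exprn_gt0//; have := sqr_ge0 k; lra.
apply/unit_ballP; split; first by apply: kK => /=; lra.
have := profile_lower_bound k0 kK p1.
have := profile_lower_bound k0 kK (_ : enorm (- (heis_dil r^-1 p).1) <= k / 16).
rewrite enormN => /(_ p1).
by move: p2; rewrite ler_norml; lra.
Qed.

Lemma hnorm_bounds (C r : R) p :
  (forall v, K v -> enorm v <= C /\ phi v <= C) -> 0 < r -> N p <= r ->
  enorm p.1 <= C * r /\ `|p.2| <= C * r ^+ 2.
Proof.
move=> KC r0; rewrite -{1}(heis_dilK p r0) hnorm_dil// -[leRHS]mulr1 ler_pM2l//.
move=> /unit_ballP[Kp /andP[pl pu]].
have [nC fC] := KC _ Kp; have [_ fC'] := KC _ (ball_projN Kp).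
split.
  rewrite -ler_pdivrMr// mulrC -[X in X * _]gtr0_norm ?invr_gt0// -enormZ.
  exact: nC.
rewrite -ler_pdivrMr ?exprn_gt0//.
have -> : `|p.2| / r ^+ 2 = `|(heis_dil r^-1 p).2|.
  by rewrite /= normrM exprVn mulrC ger0_norm ?invr_ge0 ?sqr_ge0.
by rewrite ler_norml; lra.
Qed.

End homogeneous_distance.

(** Turns the angle in the cone hypothesis into an inner product, as [cos] decreases on
    [[0, pi]]. *)
Lemma angle_le_of_edot_ge (R : realType) (v w : R * R) (alpha : R) :
  0 < alpha < pi / 2 -> v <> 0 -> w <> 0 ->
  cos alpha * (enorm v * enorm w) <= edot v w -> angle v w <= alpha.
Proof.
move=> /andP[a0 api] /enorm_gt0 v0 /enorm_gt0 w0.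
have P0 : 0 < enorm v * enorm w by rewrite mulr_gt0.
rewrite -ler_pdivlMr// /angle; set x := _ / _ => cosx.
have x1 : -1 <= x <= 1.
  rewrite -ler_norml /x normrM normfV (gtr0_norm P0) ler_pdivrMr// mul1r.
  exact: edot_le.
have [ax xpi] := (acos_ge0 x1, acos_lepi x1).
rewrite leNgt; apply/negP => alt.
have : cos (acos x) < cos alpha.
  by rewrite ltr_cos// in_itv/=; apply/andP; split; have := pi_gt0 R; lra.
by rewrite acosK ?in_itv// ltNge cosx.
Qed.

(** * Growth estimates for the profile *)

Section profile_estimates.
Context {R : realType} (d : heis R -> heis R -> R) (phi : R * R -> R).
Hypotheses (hd : homogeneous_distance d) (hphi : is_profile d phi).
Context (kappa C : R).
Hypotheses (kappa0 : 0 < kappa).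
Local Notation K := (ball_proj d).
Hypothesis kappaK : [set v | enorm v <= kappa] `<=` K°.
Hypothesis KC : forall v, K v -> enorm v <= C /\ phi v <= C.

Let lipK : locally_lipschitz K° phi.
Proof. by have [] := hphi. Qed.

(** The segment from [v - w] to [v] lies in the open disc of radius [r = 2 (|v| + |w|)], on which
    the gradient is at most [M r]. *)
Lemma profile_growth_of_grad_bound (M : R) (v w : R * R) : 0 < M ->
  {ae lebesgue2 R, forall v, enorm v <= kappa ->
     differentiable phi v /\ enorm (grad phi v) <= M * enorm v} ->
  enorm v + enorm w <= kappa / 4 ->
  phi v - phi (v - w) <= 2 * M * (enorm v + enorm w) * enorm w.
Proof.
move=> M0 gradM vw.
have [->|/eqP w0] := eqVneq w 0.
  by rewrite subr0 subrr enorm0 mulr0.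
have v0 := enorm_ge0 v; have wp := enorm_gt0 w0.
pose r := 2 * (enorm v + enorm w).
pose V := [set x : R * R | enorm x < r].
have oV : open V.
  by apply: (@open_comp _ _ (@enorm R) [set x | x < r]);
    [move=> x _; exact: continuous_enorm|exact: open_lt].
have := @segment_growth R phi V (v - w) w (M * r * enorm w) oV.
rewrite subrK.
rewrite (_ : M * r * _ = 2 * M * (enorm v + enorm w) * enorm w); last first.
  by rewrite /r; ring.
apply => //.
- move=> x /= xV; apply: lipK; apply: kappaK => /=; rewrite /V /= in xV.
  by rewrite /r in xV; lra.
- apply: negligibleS gradM => x /=; apply: contra_not => xM xr.
  have [|dx gx] := xM; first by move: xr; rewrite /V/= /r; lra.
  split=> //; apply: le_trans (ler_norm _) (le_trans (edot_le _ _) _).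
  apply: (@le_trans _ _ (M * r * enorm w)); last by rewrite /r; lra.
  rewrite ler_pM2r// (le_trans gx)// ler_pM2l//.
  exact: ltW.
- move=> t /andP[t0 t1]; rewrite /V /=.
  have -> : v - w + t *: w = v - (1 - t) *: w.
    by apply: injective_projections; rewrite /= /GRing.scale/=; ring.
  apply: le_lt_trans (enormB _ _) _; rewrite enormZ ger0_norm ?subr_ge0//.
  have : (1 - t) * enorm w <= 1 * enorm w by rewrite ler_pM2r//; lra.
  by rewrite /r; lra.
Qed.

(* With tau = t |w| / |v|, the point v - t w is (1 - tau) v + tau u where
   u = v - (|v| / |w|) w is small because v and w are almost parallel. *)
Lemma interior_of_almost_parallel (s t : R) (v w : R * R) :
  K v -> v <> 0 -> w <> 0 -> s * C <= kappa / 2 -> 0 <= s <= 1 ->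
  almost_parallel s v w -> enorm w <= s * enorm v -> 0 < t <= 1 ->
  K° (v - t *: w).
Proof.
move=> Kv /enorm_gt0 v0 /enorm_gt0 w0 sC /andP[s0 s1] vw wv /andP[t0 t1].
pose tau := t * enorm w / enorm v.
have tau0 : 0 < tau by rewrite divr_gt0// mulr_gt0.
have tau1 : tau <= 1.
  rewrite ler_pdivrMr// mul1r.
  have : t * enorm w <= 1 * enorm w by rewrite ler_pM2r.
  have : s * enorm v <= 1 * enorm v by rewrite ler_pM2r.
  lra.
pose u : R * R := v - (enorm v / enorm w) *: w.
have uk : enorm u <= kappa / 2.
  apply: le_trans sC; apply: (@le_trans _ _ (s * enorm v)); last first.
    by rewrite ler_wpM2l//; exact: (KC Kv).1.
  rewrite -(ler_pM2l w0) -[X in X * _](ger0_norm (enorm_ge0 w)) -enormZ.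
  rewrite [X in enorm X](_ : _ = enorm w *: v - enorm v *: w).
    by apply: le_trans vw _; rewrite le_eqVlt; apply/orP; left; apply/eqP; ring.
  rewrite /u; apply: injective_projections; rewrite /= /GRing.scale/=; field.
    by rewrite gt_eqF.
  by rewrite gt_eqF.
have : nbhs (v - t *: w) [set x | enorm (x - (v - t *: w)) < tau * (kappa / 2)].
  by apply: nbhs_enorm_ball; rewrite mulr_gt0// divr_gt0.
apply: filterS => x /= xt.
(* [u'] absorbs the deviation of [x] from [v - t *: w], which makes [x] a convex combination of [v]
   and [u']; still [|u'| <= kappa]. *)
pose u' : R * R := u + tau^-1 *: (x - (v - t *: w)).
have Ku' : K u'.
  apply: interior_subset; apply: kappaK => /=; apply: le_trans (enormD _ _) _.
  rewrite enormZ gtr0_norm ?invr_gt0//.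
  have : tau^-1 * enorm (x - (v - t *: w)) <= kappa / 2.
    by rewrite mulrC ler_pdivrMr// mulrC ltW.
  lra.
have xE : x = (1 - tau) *: v + tau *: u'.
  rewrite /u' /u /tau; apply: injective_projections; rewrite /= /GRing.scale/=;
  field; by rewrite !gt_eqF// lexx.
have [tau_lt|] := ltP tau 1.
  rewrite xE.
  by have [] := profile_segment hd hphi Kv Ku' (introT andP (conj tau0 tau_lt)).
by move=> tau_ge; rewrite xE (_ : tau = 1) ?subrr ?scale0r ?add0r ?scale1r//; lra.
Qed.

(* As v may lie on the boundary of K, where phi need not be continuous, the
   segment estimate is applied up to v - tau w and tau -> 0 in
   profile_segment. *)
Lemma profile_growth_of_cone (m gamma s : R) (v w : R * R) :
  0 < m -> 0 < gamma < 1 -> 0 < s -> 4 * s <= 1 - gamma ->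
  s * C <= kappa / 2 -> K v -> v <> 0 -> w <> 0 ->
  {ae lebesgue2 R, forall v, K° v -> v <> 0 ->
    differentiable phi v /\ forall w : R * R, w <> 0 ->
      gamma * (enorm v * enorm w) <= edot v w ->
      edot (grad phi v) w <= - m * enorm v * enorm w} ->
  almost_parallel s v w -> enorm w <= s * enorm v ->
  K (v - w) /\ phi v + m / 2 * (enorm v * enorm w) <= phi (v - w).
Proof.
move=> m0 /andP[g0 g1] s0 sg sC Kv v0 w0 cone vw wv.
have s01 : 0 <= s <= 1 by lra.
have nv := enorm_gt0 v0; have nw := enorm_gt0 w0.
have Kint t : 0 < t <= 1 -> K° (v - t *: w).
  exact: (interior_of_almost_parallel Kv v0 w0 sC s01 vw wv).
have Kvw : K (v - w).
  by apply: interior_subset; rewrite -[w]scale1r; apply: Kint; lra.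
split=> //.
set P := enorm v * enorm w; have P0 : 0 < P by rewrite mulr_gt0.
have evw := almost_parallel_edot s01 v0 w0 vw; rewrite -/P in evw.
pose V := K° `&` [set x | gamma * (enorm x * enorm w) < edot x w] `&`
  [set x | enorm v / 2 < enorm x].
have oV : open V.
  apply: openI; first apply: openI; first exact: open_interior.
    have -> : [set x | gamma * (enorm x * enorm w) < edot x w] =
        (fun x => edot x w - gamma * (enorm x * enorm w)) @^-1` [set y | 0 < y].
      by apply/seteqP; split=> x /=; rewrite subr_gt0.
    apply: open_comp; last exact: open_gt.
    move=> x _; apply: cvgB; first exact: continuous_edot.
    apply: cvgMr; apply: cvgMl; exact: continuous_enorm.
  apply: (@open_comp _ _ (@enorm R) [set x | _ < x]); last exact: open_gt.
  by move=> x _; exact: continuous_enorm.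
have wv4 : enorm w <= enorm v / 4.
  have : s * enorm v <= 1 / 4 * enorm v by rewrite ler_pM2r//; lra.
  lra.
(* The margin [4 s <= 1 - gamma] keeps the segment in the cone: [<v - t w, w> >= (1 - 2 s) P],
   whereas [|v - t w| |w| <= (1 + s) P]. *)
have VE t : 0 < t <= 1 -> V (v - t *: w).
  move=> t01; have [t0 t1] := andP t01.
  have tw : enorm (t *: w) <= enorm w.
    rewrite enormZ gtr0_norm//.
    have : t * enorm w <= 1 * enorm w by rewrite ler_pM2r.
    lra.
  split; first split; first exact: Kint.
    rewrite /= edotBl; have -> : edot (t *: w) w = t * enorm w ^+ 2.
      by rewrite -edotvv /edot /= /GRing.scale/=; ring.
    have : enorm (v - t *: w) * enorm w <= (1 + s) * P.
      rewrite /P mulrA ler_pM2r//; apply: le_trans (enormB _ _) _; lra.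
    rewrite -(ler_pM2l g0).
    have : t * enorm w ^+ 2 <= s * P.
      apply: (@le_trans _ _ (1 * enorm w ^+ 2)).
        by rewrite ler_wpM2r ?sqr_ge0.
      by rewrite mul1r expr2 /P mulrA ler_pM2r.
    have : gamma * (s * P) <= 1 * (s * P).
      by rewrite ler_wpM2r ?mulr_ge0 ?ltW.
    have : 4 * s * P <= (1 - gamma) * P by rewrite ler_wpM2r// ltW.
    have : 0 < s * P by rewrite mulr_gt0.
    lra.
  rewrite /=; have := enormD (v - t *: w) (t *: w); rewrite subrK.
  lra.
have lipV : locally_lipschitz V phi.
  by move=> x [[Kx _] _]; exact: lipK.
have gradV : {ae lebesgue2 R, forall x, V x ->
    differentiable phi x /\ edot (grad phi x) w <= - (m / 2 * P)}.
  apply: negligibleS cone => x /=; apply: contra_not => xcone [[Kx gx] vx].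
  have x0 : x <> 0 by move=> x0; move: vx; rewrite /= x0 enorm0; lra.
  have [dx gradx] := xcone Kx x0; split=> //.
  apply: le_trans (gradx w w0 (ltW gx)) _.
  rewrite !mulNr lerN2 /P mulrA ler_pM2r//.
  have : m * (enorm v / 2) <= m * enorm x by rewrite ler_pM2l// ltW.
  lra.
apply/ler_addgt0Pr => e e0.
(* [Q] bounds the first-order losses in [tau]: [2 phi v] from [(1 - tau)^2], [P] from [omega],
   [m / 2 * P] from the shortened segment. *)
pose Q := 2 * phi v + P + m / 2 * P + 1.
have phiv := profile_ge0 hphi Kv.
have mP : 0 < m / 2 * P by rewrite mulr_gt0// divr_gt0.
have Q0 : 0 < Q by rewrite /Q; lra.
pose tau := Num.min (1 / 2) (e / Q).
have tau0 : 0 < tau by rewrite lt_min !divr_gt0.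
have tau1 : tau <= 1 / 2 by rewrite ge_min lexx.
have tauQ : tau * Q <= e by rewrite -ler_pdivlMr// ge_min lexx orbT.
have tau1' : 0 < tau < 1 by lra.
have [_] := profile_segment hd hphi Kv Kvw tau1'.
have -> : (1 - tau) *: v + tau *: (v - w) = v - tau *: w.
  by apply: injective_projections; rewrite /= /GRing.scale/=; ring.
have -> : omega v (v - w) = - omega v w by rewrite /omega /=; ring.
have := @segment_growth R phi V (v - w) ((1 - tau) *: w)
  (- ((1 - tau) * (m / 2 * P))) oV lipV.
have -> : v - w + (1 - tau) *: w = v - tau *: w.
  by apply: injective_projections; rewrite /= /GRing.scale/=; ring.
move=> seg.
have seg' : phi (v - tau *: w) - phi (v - w) <= - ((1 - tau) * (m / 2 * P)).
  apply: seg.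
  - move=> /eqP; rewrite scaler_eq0 => /orP[/eqP|/eqP//]; lra.
  - apply: negligibleS gradV => x /=; apply: contra_not => xV Vx.
    have [dx gx] := xV Vx; split=> //.
    by rewrite edotZr -mulrN ler_wpM2l//; lra.
  - move=> t /andP[t0 t1].
    have -> : v - w + t *: ((1 - tau) *: w) = v - (1 - t * (1 - tau)) *: w.
      by apply: injective_projections; rewrite /= /GRing.scale/=; ring.
    apply: VE; have : 0 <= t * (1 - tau) by rewrite mulr_ge0//; lra.
    have : t * (1 - tau) <= 1 * (1 - tau) by rewrite ler_wpM2r//; lra.
    lra.
have := profile_ge0 hphi Kvw.
have := omega_le v w; rewrite -/P => /ler_normlP[_ om].
set F := phi (v - w) in seg' *; set G := phi (v - tau *: w) in seg' * => F0 FG.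
have : 0 <= tau ^+ 2 * F by rewrite mulr_ge0// sqr_ge0.
have : 0 <= tau ^+ 2 * phi v by rewrite mulr_ge0// sqr_ge0.
have : tau * (1 - tau) * omega v w <= tau * P.
  have [h0|h0] := leP 0 (omega v w).
    have : 0 <= tau * (tau * omega v w) by rewrite !(mulr_ge0 (ltW tau0)).

    have : tau * omega v w <= tau * P by rewrite ler_pM2l.
    lra.
  apply: (@le_trans _ _ 0); last by rewrite mulr_ge0 ?ltW.
  by rewrite pmulr_rle0 ?ltW// mulr_gt0//; lra.
have : 0 < tau * P by rewrite mulr_gt0.
move: tauQ; rewrite /Q.
lra.
Qed.

End profile_estimates.

(** * Points of different scales *)

Section nearby_directions.
Context {R : realType} (d : heis R -> heis R -> R) (phi : R * R -> R).
Hypotheses (hd : homogeneous_distance d) (hphi : is_profile d phi).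
Local Notation K := (ball_proj d).
Local Notation N := (d (heis0 R)).
Context (kappa C s mu M : R).
Hypotheses (kappa0 : 0 < kappa) (kappaK : [set v | enorm v <= kappa] `<=` K).
Hypotheses (C1 : 1 <= C) (KC : forall v, K v -> enorm v <= C /\ phi v <= C).
Hypotheses (s01 : 0 < s < 1) (smu : s <= mu) (M0 : 0 < M).
Hypothesis cone : forall v w, K v -> v <> 0 -> w <> 0 ->
  almost_parallel s v w -> enorm w <= s * enorm v ->
  K (v - w) /\ phi v + mu * (enorm v * enorm w) <= phi (v - w).
Hypothesis lip : forall v w, enorm v + enorm w <= kappa / 4 ->
  phi v - phi (v - w) <= 2 * M * (enorm v + enorm w) * enorm w.

(** If [|w| <= s |v|], the cone gain [mu |v| |w|] absorbs [omega]. Otherwise [|v| < |w| / s], so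
    [omega] and the drop of [phi] are [O(|w|^2)] and are paid by [t >= Lam |w|^2]. *)
Let steep (v w : R * R) (z t Lam : R) : K v -> z <= phi v ->
  almost_parallel s v w -> (2 * M + 1) * (s^-1 + 1) <= Lam ->
  enorm v + enorm w <= kappa / 4 -> Lam * enorm w ^+ 2 <= t ->
  z - t + `|omega v w| / 2 <= phi (v - w).
Proof.
have [s0 s1] := andP s01.
move=> Kv zv vw LamE vwk wt.
have v0 := enorm_ge0 v; have w0 := enorm_ge0 w.
have L0 : 0 <= Lam.
  by apply: le_trans LamE; rewrite mulr_ge0 ?addr_ge0 ?mulr_ge0 ?invr_ge0// ltW.
have t0 : 0 <= t by apply: le_trans wt; rewrite mulr_ge0// sqr_ge0.
have [w00|/eqP wn0] := eqVneq w 0.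
  by rewrite w00 subr0 /omega /= !mulr0 subrr normr0; lra.
have wp := enorm_gt0 wn0.
have om := omega_le v w.
have [wv|vw'] := leP (enorm w) (s * enorm v).
  have vn0 : v <> 0 by move=> v00; move: wv; rewrite v00 enorm0 mulr0; lra.
  have [_] := cone Kv vn0 wn0 vw wv.
  have := almost_parallel_omega vw.
  have P0 : 0 <= enorm v * enorm w by rewrite mulr_ge0.
  have : s * (enorm v * enorm w) <= mu * (enorm v * enorm w).
    by rewrite ler_wpM2r.
  have : 0 <= s * (enorm v * enorm w) by rewrite mulr_ge0// ltW.
  lra.
have vsw : enorm v <= s^-1 * enorm w by rewrite ler_pdivlMl// ltW.
have := lip vwk.
have : (2 * M * (enorm v + enorm w) + enorm v) * enorm w <= Lam * enorm w ^+ 2.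
  rewrite expr2 mulrA ler_pM2r//; 
  apply: (@le_trans _ _ ((2 * M + 1) * (s^-1 + 1) * enorm w)).
    have : (2 * M + 1) * (enorm v + enorm w) <=
        (2 * M + 1) * ((s^-1 + 1) * enorm w).
      have M1 : 0 < 2 * M + 1 by have := M0; lra.
      by rewrite (ler_pM2l M1) mulrDl mul1r lerD2r.
    rewrite mulrA; lra.
  by rewrite ler_pM2r.
have : 0 <= enorm v * enorm w by rewrite mulr_ge0.
lra.
Qed.

(** Half of the cone gain pays for [t], the other half for [omega], since [s <= mu]. *)
Let flat (v w : R * R) (z t : R) : K v -> z <= phi v -> v <> 0 -> w <> 0 ->
  almost_parallel s v w -> enorm w <= s * enorm v ->
  `|t| <= mu / 2 * (enorm v * enorm w) ->
  K (v - w) /\ z - t + `|omega v w| / 2 <= phi (v - w).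
Proof.
move=> Kv zv v0 w0 vw wv tle.
have [Kvw phivw] := cone Kv v0 w0 vw wv; split=> //.
have := almost_parallel_omega vw.
have P0 : 0 <= enorm v * enorm w by rewrite mulr_ge0 ?enorm_ge0.
have : s * (enorm v * enorm w) <= mu * (enorm v * enorm w) by rewrite ler_wpM2r.
by have := ler_norm (- t); rewrite normrN; lra.
Qed.

(** Invariant under dilations, which permits the normalization [N p = 1]. The equalities are between
    booleans, which a colour can record. *)
Definition same_class (Lam : R) (p q : heis R) :=
  [/\ almost_parallel s p.1 q.1, (0 <= p.2) = (0 <= q.2) &
    (Lam * enorm p.1 ^+ 2 <= `|p.2|) = (Lam * enorm q.1 ^+ 2 <= `|q.2|)].

(** With [|omega|] in both bounds, the second is the first for the inverses of [p] and [q], so each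
    estimate serves twice. *)
Lemma hnorm_heis_inv_mul_le (p q : heis R) :
  K (p.1 - q.1) ->
  p.2 - q.2 + `|omega p.1 q.1| / 2 <= phi (p.1 - q.1) ->
  - p.2 + q.2 + `|omega p.1 q.1| / 2 <= phi (- p.1 + q.1) ->
  N (heis_mul (heis_inv p) q) <= 1.
Proof.
move=> Kpq up lo; apply/(unit_ballP hphi).
rewrite /heis_mul /heis_inv /= opprD opprK; split.
  by rewrite addrC -opprB; exact: (ball_projN hd).
have -> : omega (- p.1) q.1 = - omega p.1 q.1 by rewrite /omega /=; ring.
have := ler_norm (omega p.1 q.1); have := ler_norm (- omega p.1 q.1).
by rewrite normrN; lra.
Qed.

Let normalized_same_class :
  exists Lam eps : R, 0 < eps < 1 /\ forall p q : heis R,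
    N p = 1 -> N q <= eps -> same_class Lam p q ->
    N (heis_mul (heis_inv p) q) <= 1.
Proof.
have [s0 s1] := andP s01.
have [[hM hC] hk] := (M0, C1, kappa0).
have mu0 : 0 < mu by apply: lt_le_trans s0 smu.
pose a := kappa / 16; have a0 : 0 < a by rewrite divr_gt0.
(* The first summand is what [steep] asks for; the second forces [|v| <= a / 2] at a steep point,
   where [|z| <= C]. *)
pose Lam := (2 * M + 1) * (s^-1 + 1) + C / (a / 2) ^+ 2.
have Lam1 : (2 * M + 1) * (s^-1 + 1) <= Lam.
  by rewrite lerDl divr_ge0 ?sqr_ge0//; lra.
have Lam2 : C <= Lam * (a / 2) ^+ 2.
  rewrite -ler_pdivrMr ?exprn_gt0 ?divr_gt0// lerDr.
  by rewrite mulr_ge0// ?addr_ge0 ?invr_ge0 ?mulr_ge0// ltW.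
have Lam0 : 0 < Lam.
  by rewrite ltr_pwDl ?divr_ge0 ?sqr_ge0 ?mulr_gt0 ?addr_gt0 ?invr_gt0//; lra.
have L1 : 0 < 1 + Lam by lra.
(* A lower bound of [|v|] at a flat point of norm 1: below [c] the point would fit the box of
   [hnorm_le_of_box] of radius [1 / 2]. *)
pose c := a / 2 / (1 + Lam); have c0 : 0 < c by rewrite !divr_gt0.
have ca : c <= a / 2.
  rewrite /c (ler_pdivrMr _ _ L1).
  have : 0 < a / 2 * Lam by rewrite mulr_gt0// divr_gt0.
  lra.
have Lc : Lam * c ^+ 2 <= (a / 2) ^+ 2.
  have : Lam * c <= a / 2.
    have : c * (1 + Lam) = a / 2 by rewrite /c divfK// gt_eqF.
    lra.
  move=> Lc; have c0' := ltW c0; have Lam0' := ltW Lam0.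
  have := ler_pM (mulr_ge0 Lam0' c0') c0' Lc ca.
  lra.
(* In order, the bounds give [eps < 1], the domain of [lip], the inequality [small], and in the flat
   case [|w| <= s |v|] and the bound on [t]. *)
pose eps := Num.min (1 / 2) (Num.min (a / C)
  (Num.min ((a / 2) ^+ 2 / (2 * C ^+ 2))
  (Num.min (s * c / C) (mu * c / (2 * Lam * C))))).
have C0 : 0 < C by lra.
have e0 : 0 < eps.
  have a2 : 0 < a / 2 by rewrite divr_gt0.
  rewrite !lt_min; apply/and5P.
  by split; apply: divr_gt0 => //;
    rewrite ?exprn_gt0// !mulr_gt0// ?exprn_gt0 ?invr_gt0.
have e1 : eps <= 1 / 2 by rewrite !ge_min lexx.
have e2 : C * eps <= a.
  by rewrite mulrC -ler_pdivlMr// !ge_min lexx !orbT.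
have e3 : 2 * C ^+ 2 * eps <= (a / 2) ^+ 2.
  by rewrite mulrC -ler_pdivlMr ?mulr_gt0 ?exprn_gt0// !ge_min lexx !orbT.
have e4 : C * eps <= s * c.
  by rewrite mulrC -ler_pdivlMr// !ge_min lexx !orbT.
have e5 : 2 * Lam * C * eps <= mu * c.
  by rewrite mulrC -ler_pdivlMr ?mulr_gt0// !ge_min lexx !orbT.
exists Lam, eps; split; first by lra.
move=> p q Np Nq [vw sgn cls].
have Np1 : N p <= 1 by rewrite Np.
have := hnorm_bounds hd hphi KC ltr01 Np1; rewrite expr1n !mulr1 => -[pC zC].
have [wC tC] := hnorm_bounds hd hphi KC e0 Nq.
have /(unit_ballP hphi)[Kp /andP[plo pup]] : N p <= 1 by rewrite Np.
have KNp := ball_projN hd Kp.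
have v0 := enorm_ge0 p.1; have w0 := enorm_ge0 q.1.
have vwN := almost_parallelNN vw.
have big : enorm p.1 <= a / 2 -> (a / 2) ^+ 2 < `|p.2|.
  move=> va; rewrite ltNge; apply/negP => za.
  have : N p <= 2^-1.
    by apply: (hnorm_le_of_box hd hphi kappa0 kappaK) => //.
  by rewrite Np; lra.
have [vert|] := boolP (Lam * enorm p.1 ^+ 2 <= `|p.2|).
  have vert' : Lam * enorm q.1 ^+ 2 <= `|q.2| by rewrite -cls.
  have va : enorm p.1 <= a / 2.
    have a20 : 0 <= a / 2 by rewrite ltW// divr_gt0.
    rewrite -(ler_pXn2r (n := 2)) ?nnegrE//.
    by rewrite -(ler_pM2l Lam0); apply: le_trans vert (le_trans zC Lam2).
  have zbig := big va.
  have vwk : enorm p.1 + enorm q.1 <= kappa / 4.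
    by move: va wC e2 hk; rewrite /a; lra.
  have Kpq : K (p.1 - q.1).
    by apply: kappaK => /=; apply: le_trans (enormB _ _) _; move: hk; lra.
  have KqNp : K (- p.1 + q.1) by rewrite addrC -opprB; exact: (ball_projN hd).
  (* As [z] and [t] have the same sign, [steep] is needed for only one of the two bounds; in the
     other the left side is at most [|t| + |omega| / 2 - |z| <= 0]. *)
  have small : `|q.2| + `|omega p.1 q.1| / 2 <= `|p.2|.
    apply: le_trans (ltW zbig); apply: le_trans e3.
    have Ce : 0 < C * eps by rewrite mulr_gt0.
    have : C * eps * eps <= C * eps * C by rewrite (ler_pM2l Ce); lra.
    have : enorm p.1 * enorm q.1 <= C * (C * eps) by apply: ler_pM.
    have := omega_le p.1 q.1.
    have : 0 < C * (C * eps) by rewrite mulr_gt0.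
    lra.
  apply: hnorm_heis_inv_mul_le => //.
    have [z0|z0] := leP 0 p.2.
      have t0 : 0 <= q.2 by rewrite -sgn.
      by apply: (steep Kp pup vw Lam1 vwk); rewrite -(ger0_norm t0).
    have := profile_ge0 hphi Kpq.
    have t0 : q.2 < 0 by rewrite ltNge -sgn -ltNge.
    by move: small; rewrite (ltr0_norm t0) (ltr0_norm z0); lra.
  have [z0|z0] := leP 0 p.2.
    have := profile_ge0 hphi KqNp.
    have t0 : 0 <= q.2 by rewrite -sgn.
    by move: small; rewrite (ger0_norm t0) (ger0_norm z0); lra.
  have t0 : q.2 < 0 by rewrite ltNge -sgn -ltNge.
  have zN : - p.2 <= phi (- p.1) by lra.
  have vwkN : enorm (- p.1) + enorm (- q.1) <= kappa / 4 by rewrite !enormN.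
  have tN : Lam * enorm (- q.1) ^+ 2 <= - q.2 by rewrite enormN -(ltr0_norm t0).
  by have := steep KNp zN vwN Lam1 vwkN tN; rewrite omegaNN !opprK.
move=> horz; have horz' := horz.
rewrite cls -ltNge in horz'; rewrite -ltNge in horz.
have q0 : q.1 <> 0.
  move=> q0; move: horz'; rewrite q0 enorm0 expr0n/= mulr0.
  by rewrite ltNge normr_ge0.
have cv : c <= enorm p.1.
  rewrite leNgt; apply/negP => vc.
  have : (a / 2) ^+ 2 < `|p.2| by apply: big; lra.
  have : Lam * enorm p.1 ^+ 2 <= Lam * c ^+ 2.
    by rewrite ler_pM2l// ler_pXn2r ?nnegrE// ltW.
  lra.
have p0 : p.1 <> 0 by move=> p0; move: cv; rewrite p0 enorm0; lra.
have wv : enorm q.1 <= s * enorm p.1.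
  by apply: le_trans wC (le_trans e4 _); rewrite ler_pM2l.
have tle : `|q.2| <= mu / 2 * (enorm p.1 * enorm q.1).
  apply: (le_trans (ltW horz')).
  rewrite expr2 !mulrA ler_wpM2r//.
  have : Lam * enorm q.1 <= Lam * (C * eps) by rewrite ler_pM2l.
  have : mu * c <= mu * enorm p.1 by rewrite ler_pM2l.
  lra.
have [Kpq up] := flat Kp pup p0 q0 vw wv tle.
apply: hnorm_heis_inv_mul_le => //.
have zN : - p.2 <= phi (- p.1) by lra.
have pN0 : - p.1 <> 0 by move=> /eqP; rewrite oppr_eq0 => /eqP.
have qN0 : - q.1 <> 0 by move=> /eqP; rewrite oppr_eq0 => /eqP.
have wvN : enorm (- q.1) <= s * enorm (- p.1) by rewrite !enormN.
have tN : `|- q.2| <= mu / 2 * (enorm (- p.1) * enorm (- q.1)).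
  by rewrite normrN !enormN.
by have [_] := flat KNp zN pN0 qN0 vwN wvN tN; rewrite omegaNN !opprK.
Qed.

Lemma dist_le_of_same_class :
  exists Lam eps : R, 0 < eps < 1 /\ forall p q : heis R,
    0 < N p -> N q <= eps * N p -> same_class Lam p q -> d p q <= N p.
Proof.
have [Lam [eps [e01 H]]] := normalized_same_class.
exists Lam, eps; split=> // p q Np Nq [vw sgn cls].
pose r := N p; have r0 : 0 < r := Np.
have ri : 0 < r^-1 by rewrite invr_gt0.
have [_ _ dil] := hd.
rewrite -(heis_dilK p r0) -{1}(heis_dilK q r0) dil//.
rewrite -/r hnorm_dil// ler_pM2l// (dist_heis_inv hd).
have -> : N (heis_dil r^-1 p) = 1 by rewrite hnorm_dil// mulVf// gt_eqF.
apply: H.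
- by rewrite hnorm_dil// mulVf// gt_eqF.
- by rewrite hnorm_dil// mulrC ler_pdivrMr.
have ri2 : 0 < r^-1 ^+ 2 by rewrite exprn_gt0.
split=> /=.
- move: vw; rewrite /almost_parallel.
  have E (x : R * R) : (r^-1 * x.1, r^-1 * x.2) = r^-1 *: x by [].
  rewrite !E !enormZ (gtr0_norm ri).
  have -> : (r^-1 * enorm q.1) *: (r^-1 *: p.1) -
      (r^-1 * enorm p.1) *: (r^-1 *: q.1) =
      r^-1 ^+ 2 *: (enorm q.1 *: p.1 - enorm p.1 *: q.1).
    by apply: injective_projections; rewrite /= /GRing.scale/=; ring.
  rewrite enormZ (gtr0_norm ri2).
  have -> : s * (r^-1 * enorm p.1 * (r^-1 * enorm q.1)) =
    r^-1 ^+ 2 * (s * (enorm p.1 * enorm q.1)) by ring.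
  by rewrite ler_pM2l.
- by rewrite !pmulr_rge0.
- have E (x : R * R) : (r^-1 * x.1, r^-1 * x.2) = r^-1 *: x by [].
  rewrite !E !enormZ (gtr0_norm ri) (normrM _ p.2) (normrM _ q.2).
  rewrite (gtr0_norm ri2) !exprMn.
  have E2 x : Lam * (r^-1 ^+ 2 * x) = r^-1 ^+ 2 * (Lam * x) by ring.
  by rewrite !E2 !(ler_pM2l ri2).
Qed.

End nearby_directions.

(** * Colouring *)

Lemma fine_grid (R : realType) (B eta : R) : 0 < eta ->
  exists n (f : R -> 'I_n.+1), forall x y, `|x| <= B -> `|y| <= B ->
    f x = f y -> `|x - y| <= eta.
Proof.
move=> eta0; pose n := Num.truncn (2 * B / eta).
(* For [|x| <= B] the index is at most [n], so [inord] does not fall back on its default. *)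
exists n, (fun x => inord (Num.truncn ((x + B) / eta))).
have lt_n x : `|x| <= B -> (Num.truncn ((x + B) / eta) < n.+1)%N /\
    0 <= (x + B) / eta.
  rewrite ler_norml => /andP[Bx xB]; have xB0 : 0 <= (x + B) / eta.
    by rewrite divr_ge0// ?(ltW eta0)//; lra.
  split=> //; rewrite ltnS le_truncn// ler_pM2r ?invr_gt0//; lra.
move=> x y /lt_n[xn x0] /lt_n[yn y0] /(congr1 val) /=.
rewrite !inordK// => E.
have := truncn_itv x0; have := truncn_itv y0; rewrite -E.
set k := (Num.truncn _) => /andP[ky yk] /andP[kx xk].
rewrite -natr1 in yk xk.
have D : `|(x + B) / eta - (y + B) / eta| <= 1 by rewrite ler_norml; lra.
rewrite -(@ler_pM2r _ eta^-1) ?invr_gt0// divff ?gt_eqF//.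
rewrite -[X in _ * X](gtr0_norm (_ : 0 < eta^-1)) ?invr_gt0// -normrM.
by move: D; rewrite -mulrBl opprD addrACA subrr addr0.
Qed.

Lemma card_le_of_coloring (T : Type) (c : finType) (F : set T) (f : T -> c) :
  (forall x y, F x -> F y -> f x = f y -> x = y) -> (F #<= `I_#|c|)%card.
Proof.
move=> finj; pose g x : nat := enum_rank (f x).
have ginj : {in F &, injective g}.
  by move=> x y /set_mem Fx /set_mem Fy /val_inj/enum_rank_inj; exact: finj.
have /card_eqPle[le _] : (F #= g @` F)%card.
  by rewrite card_eq_sym; exact: inj_card_eq.
apply: card_le_trans le _; apply: subset_card_le => _ [x _ <-].
exact: ltn_ord.
Qed.

(** Distinct scales of the same parity are two apart, the gap that [scale_of] requires. *)
Lemma lt_same_parity (a b : int) :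
  ((a %% 2)%Z == 0) = ((b %% 2)%Z == 0) -> a < b -> a + 2 <= b.
Proof. lia. Qed.

Section coloring.
Context {R : realType} (d : heis R -> heis R -> R).
Hypothesis hd : homogeneous_distance d.
Local Notation N := (d (heis0 R)).

Lemma BCP_of_coloring (c : finType) (f : heis R -> c) :
  (forall p q, 0 < N p -> 0 < N q -> f p = f q ->
    d p q <= Num.max (N p) (N q)) ->
  BCP d.
Proof.
move=> fd; have [[d0 deq sym tri] dl _] := hd.
exists #|c|.+1 => // F [rad sep [x Fx]].
apply: (@card_le_trans _ _ _ `I_#|c|); last by rewrite card_le_II.
pose pos (b : heis R * R) := heis_mul (heis_inv x) b.1.
have dpos b b' : d (pos b) (pos b') = d b.1 b'.1 by rewrite dl.
have Npos b : N (pos b) = d b.1 x.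
  by rewrite [RHS]sym [RHS](dist_heis_inv hd).
apply: (@card_le_of_coloring _ c F (f \o pos)) => b b' Fb Fb' /= fE.
apply: contrapT => bb'.
have lt1 : N (pos b') < d (pos b) (pos b').
  have /negP := sep b b' Fb Fb' (nesym bb').
  rewrite /cball /= -ltNge dpos Npos sym; apply: le_lt_trans.
  exact: Fx Fb'.
have lt2 : N (pos b) < d (pos b) (pos b').
  have /negP := sep b' b Fb' Fb bb'.
  rewrite /cball /= -ltNge dpos Npos; apply: le_lt_trans.
  exact: Fx Fb.
have N0 p : N p = 0 -> p = heis0 R by move=> /deq.
(* A centre at the common point would be at distance exactly [N (pos b')] from the other centre,
   against [lt1]. *)
have pb0 : 0 < N (pos b).
  rewrite lt0r d0 andbT; apply/eqP => /N0 pb.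
  by move: lt1; rewrite pb ltxx.
have pb0' : 0 < N (pos b').
  rewrite lt0r d0 andbT; apply/eqP => /N0 pb.
  by move: lt2; rewrite pb sym ltxx.
by have := fd _ _ pb0 pb0' fE; rewrite leNgt gt_max lt1 lt2.
Qed.

Lemma almost_parallel_of_dir (s : R) (v w : R * R) : 0 <= s ->
  enorm ((enorm v)^-1 *: v - (enorm w)^-1 *: w) <= s -> almost_parallel s v w.
Proof.
move=> s0; rewrite /almost_parallel.
have [->|/eqP v0] := eqVneq v 0.
  by rewrite enorm0 !scaler0 scale0r subrr enorm0 mul0r mulr0.
have [->|/eqP w0] := eqVneq w 0.
  by rewrite enorm0 !scaler0 scale0r subrr enorm0 !mulr0.
have {}v0 := enorm_gt0 v0; have {}w0 := enorm_gt0 w0.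
have P0 : 0 < enorm v * enorm w by rewrite mulr_gt0.
rewrite -(ler_pM2r P0) => vw; apply: le_trans vw; rewrite mulrC.
rewrite -[X in X * _](gtr0_norm P0) -enormZ le_eqVlt.
apply/orP; left; apply/eqP.
congr enorm; apply: injective_projections; rewrite /= /GRing.scale/=; field;
  by rewrite !gt_eqF.
Qed.

Context (phi : R * R -> R).
Hypothesis hphi : is_profile d phi.
Local Notation K := (ball_proj d).
Context (kappa C : R).
Hypotheses (kappa0 : 0 < kappa) (kappaK : [set v | enorm v <= kappa] `<=` K).
Hypotheses (C1 : 1 <= C) (KC : forall v, K v -> enorm v <= C /\ phi v <= C).

(** The horizontal part of [p^-1 q] is at most [2 eta], and its height differs from [q.2 - p.2] by
    [omega p.1 (q.1 - p.1) / 2], at most [B eta]; so it fits the box of [hnorm_le_of_box]. *)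
Lemma dist_le1_of_close (B : R) : 0 < B -> exists2 eta, 0 < eta &
  forall p q : heis R, enorm p.1 <= B ->
    `|p.1.1 - q.1.1| <= eta -> `|p.1.2 - q.1.2| <= eta -> `|p.2 - q.2| <= eta ->
    d p q <= 1.
Proof.
move=> B0; pose b := kappa / 16; have b0 : 0 < b by rewrite divr_gt0.
pose eta := Num.min (b / 2) (b ^+ 2 / (1 + B)).
have B1 : 0 < 1 + B by lra.
have eta1 : eta <= b / 2 by rewrite ge_min lexx.
have eta2 : eta * (1 + B) <= b ^+ 2 by rewrite -ler_pdivlMr// ge_min lexx orbT.
exists eta; first by rewrite lt_min !divr_gt0// exprn_gt0.
move=> p q pB h1 h2 h3; rewrite (dist_heis_inv hd).
have h12 : enorm (- p.1 + q.1) <= 2 * eta.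
  apply: le_trans (enorm_le_sum _) _.
  by rewrite /= ![- _ + _]addrC distrC [X in _ + X]distrC; lra.
apply: (hnorm_le_of_box hd hphi kappa0 kappaK) => //;
  rewrite /heis_mul /heis_inv /= mulr1.
  by rewrite -/b; lra.
have -> : omega (- p.1) q.1 = - omega p.1 (- p.1 + q.1).
  by rewrite /omega /=; ring.
have om : `|omega p.1 (- p.1 + q.1)| <= B * (2 * eta).
  by apply: le_trans (omega_le _ _) _; apply: ler_pM => //; exact: enorm_ge0.
have h3' : `|- p.2 + q.2| <= eta by rewrite addrC distrC.
have h4 : `|- omega p.1 (- p.1 + q.1) / 2| <= B * eta.
  by rewrite normrM normrN [X in _ * X]ger0_norm ?invr_ge0//; lra.
by rewrite -/b; apply: le_trans (ler_normD _ _) _; lra.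
Qed.

(** Rounding [ln (N p)] down in units of [- ln eps] gives [eps^(-k) <= N p < eps^(-k-1)]. Rounding
    loses one unit, so a ratio [eps] takes a gap of two scales. *)
Lemma scale_of (eps : R) : 0 < eps < 1 -> exists k : heis R -> int, forall p q,
  0 < N p -> 0 < N q ->
  expR (- ln eps * (k p)%:~R) <= N p < expR (- ln eps * (k p)%:~R) / eps /\
  (k q + 2 <= k p -> N q <= eps * N p).
Proof.
move=> /andP[e0 e1]; pose L := - ln eps.
have L0 : 0 < L by rewrite oppr_gt0 ln_lt0// e0.
exists (fun p => Num.floor (ln (N p) / L)) => p q Np Nq; rewrite -/L.
have lek x : (Num.floor (ln (N x) / L))%:~R * L <= ln (N x).
  by rewrite -ler_pdivlMr// floor_le.
have ltk x : ln (N x) < ((Num.floor (ln (N x) / L))%:~R + 1) * L.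
  by have := floorD1_gt (ln (N x) / L); rewrite intrD ltr_pdivrMr.
have eL : eps^-1 = expR L by rewrite expRN lnK.
have NE x : 0 < N x -> N x = expR (ln (N x)) by move=> Nx; rewrite lnK// posrE.
have ltp := ltk p; have ltq := ltk q; have lep := lek p; have leq := lek q.
split.
  move: lep ltp; set x := (Num.floor _)%:~R => lep ltp.
  rewrite (NE p Np) eL -expRD ler_expR ltr_expR; apply/andP; split; lra.
rewrite -(ler_int R) intrD; move: lep ltp leq ltq.
set x := (Num.floor _)%:~R; set y := (Num.floor _)%:~R => lep _ _ ltq yx.
rewrite (NE p Np) (NE q Nq) -[X in X * _](lnK (_ : eps \is Num.pos)) ?posrE//.
rewrite -expRD ler_expR.
have : (y + 2) * L <= x * L by rewrite ler_pM2r.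
rewrite -[ln eps]opprK -/L; lra.
Qed.

Lemma BCP_of_same_class (s Lam eps : R) : 0 < s -> 0 < eps < 1 ->
  (forall p q, 0 < N p -> N q <= eps * N p -> same_class s Lam p q ->
    d p q <= N p) ->
  BCP d.
Proof.
move=> s0 e01 H; have [e0 e1] := andP e01.
have [[d0 _ sym _] _ dil] := hd.
have C0 : 0 < C by have := C1; lra.
have [k kP] := scale_of e01.
pose rho p := expR (- ln eps * (k p)%:~R).
pose nrm p := heis_dil (rho p)^-1 p.
have rho0 p : 0 < rho p by exact: expR_gt0.
have B0 : 0 < C * eps^-1 by rewrite divr_gt0.
have [eta eta0 close] := dist_le1_of_close B0.
(* Mesh [s / 2] because the errors of two coordinates add up. The ranges of the next two grids come
   from [hnorm_bounds], since rescaled points have norm at most [1 / eps]. *)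
have [n1 [f1 f1P]] := @fine_grid R 1 (s / 2) (divr_gt0 s0 (ltr0Sn _ _)).
have [n2 [f2 f2P]] := @fine_grid R (C * eps^-1) eta eta0.
have [n3 [f3 f3P]] := @fine_grid R (C * eps^-1 ^+ 2) eta eta0.
pose dir (v : R * R) := (enorm v)^-1 *: v.
have dir1 v : `|(dir v).1| <= 1 /\ `|(dir v).2| <= 1.
  have n1' : enorm (dir v) <= 1.
    rewrite /dir enormZ ger0_norm ?invr_ge0 ?enorm_ge0//.
    have [->|n0] := eqVneq (enorm v) 0; first by rewrite mulr0.
    by rewrite mulVf.
  split; first by apply: le_trans (fst_le_enorm _) _.
  by apply: le_trans (snd_le_enorm _) _.
pose color (p : heis R) := ((f1 (dir p.1).1, f1 (dir p.1).2),
  (0 <= p.2, Lam * enorm p.1 ^+ 2 <= `|p.2|, (k p %% 2)%Z == 0),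
  (f2 (nrm p).1.1, f2 (nrm p).1.2, f3 (nrm p).2)).
apply: (@BCP_of_coloring _ color) => p q Np Nq [fd1 fd2 fs fc fk fx fy fz].
have par v w : f1 (dir v).1 = f1 (dir w).1 -> f1 (dir v).2 = f1 (dir w).2 ->
    almost_parallel s v w.
  move=> /f1P h1 /f1P h2; apply: almost_parallel_of_dir; first exact: ltW.
  apply: le_trans (enorm_le_sum _) _; rewrite /= -/(dir v) -/(dir w).
  have [v1 v2] := dir1 v; have [w1 w2] := dir1 w.
  by have := h1 v1 w1; have := h2 v2 w2; rewrite /dir /=; lra.
have [kpq|kqp|kE] := ltgtP (k p) (k q).
- rewrite le_max sym H ?orbT//.
    by apply: (kP q p Nq Np).2; apply: lt_same_parity.
  by split; [exact: par|rewrite fs|rewrite fc].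
- rewrite le_max H//.
    by apply: (kP p q Np Nq).2; apply: lt_same_parity.
  by split; [exact: par|rewrite fs|rewrite fc].
have rhoE : rho q = rho p by rewrite /rho kE.
have [/andP[Nlo Nhi] _] := kP p q Np Nq; rewrite -/(rho p) in Nlo Nhi.
have bound x : 0 < N x -> enorm (nrm x).1 <= C * eps^-1 /\
    `|(nrm x).2| <= C * eps^-1 ^+ 2.
  move=> Nx; apply: (hnorm_bounds hd hphi KC); first by rewrite invr_gt0.
  rewrite hnorm_dil ?invr_gt0// mulrC ler_pdivrMr//.
  by have [/andP[_ /ltW]] := kP x x Nx Nx; rewrite mulrC.
have [p1 p2] := bound p Np; have [q1 q2] := bound q Nq.
(* At equal scales [d p q] is [rho p] times the distance of the rescaled points and [rho p <= N p],
   so it suffices that this distance be at most 1. *)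
rewrite le_max; apply/orP; left; apply: le_trans Nlo.
have -> : d p q = rho p * d (nrm p) (nrm q).
  by rewrite /nrm rhoE -dil// !heis_dilK.
rewrite -[leRHS]mulr1 ler_pM2l//.
apply: close => //.
- by apply: f2P => //; apply: le_trans (fst_le_enorm _) _.
- by apply: f2P => //; apply: le_trans (snd_le_enorm _) _.
- exact: f3P.
Qed.

End coloring.

(** * Choice of the aperture and conclusion *)

Theorem theorem1p4 (R : realType) (d : heis R -> heis R -> R)
    (phi : R * R -> R) (hd : homogeneous_distance d) (hphi : is_profile d phi)
    (hcone : exists m alpha : R,
      [/\ 0 < m, 0 < alpha < pi / 2 &
          {ae lebesgue2 R, forall v : R * R,
            (ball_proj d)° v -> v <> 0 ->
            differentiable phi v /\
            forall w : R * R, w <> 0 -> angle v w <= alpha ->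
              edot (grad phi v) w <= - m * enorm v * enorm w}])
    (hlip : exists kappa M : R,
      [/\ 0 < kappa, 0 < M,
          [set v : R * R | enorm v <= kappa] `<=` (ball_proj d)° &
          {ae lebesgue2 R, forall v : R * R,
            enorm v <= kappa ->
            differentiable phi v /\ enorm (grad phi v) <= M * enorm v}]) :
  BCP d.
Proof.
have [m [alpha [m0 alpha0 cone]]] := hcone.
have [kappa [M [kappa0 M0 kappaK gradM]]] := hlip.
have kappaK' : [set v | enorm v <= kappa] `<=` ball_proj d.
  exact: subset_trans kappaK (@interior_subset _ _).
have [C C1 KC] := ball_proj_bounded hd hphi kappa0 kappaK'.
have [a0 api] := andP alpha0.
pose gamma := cos alpha.
have g01 : 0 < gamma < 1.
  apply/andP; split; first by apply: cos_gt0_pihalf; lra.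
  rewrite -(cos0 R) ltr_cos// in_itv/=; apply/andP; split; lra.
have [g0 g1] := andP g01.
(* The three bounds keep nearby directions inside the cone, let the gain [m / 2] absorb [omega], and
   keep [u] of [interior_of_almost_parallel] within [kappa / 2] of 0. *)
pose s := Num.min ((1 - gamma) / 4) (Num.min (m / 2) (kappa / 2 / C)).
have C0 : 0 < C by lra.
have s0 : 0 < s by rewrite !lt_min !divr_gt0//; lra.
have sg : 4 * s <= 1 - gamma.
  by rewrite mulrC -ler_pdivlMr// ge_min lexx.
have sm : s <= m / 2 by rewrite !ge_min lexx orbT.
have sC : s * C <= kappa / 2 by rewrite -ler_pdivlMr// !ge_min lexx !orbT.
have s01 : 0 < s < 1 by lra.
have cone' : {ae lebesgue2 R, forall v, (ball_proj d)° v -> v <> 0 ->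
    differentiable phi v /\ forall w : R * R, w <> 0 ->
      gamma * (enorm v * enorm w) <= edot v w ->
      edot (grad phi v) w <= - m * enorm v * enorm w}.
  apply: negligibleS cone => v /=; apply: contra_not => H Kv v0.
  have [dv gv] := H Kv v0; split=> // w w0 vw; apply: gv => //.
  exact: angle_le_of_edot_ge.
have growth_cone v w : ball_proj d v -> v <> 0 -> w <> 0 ->
    almost_parallel s v w -> enorm w <= s * enorm v ->
    ball_proj d (v - w) /\ phi v + m / 2 * (enorm v * enorm w) <= phi (v - w).
  move=> Kv v0 w0.
  exact: (profile_growth_of_cone hd hphi kappa0 kappaK KC m0 g01 s0 sg sC Kv).
have growth_lip v w : enorm v + enorm w <= kappa / 4 ->
    phi v - phi (v - w) <= 2 * M * (enorm v + enorm w) * enorm w.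
  exact: (profile_growth_of_grad_bound hphi kappaK M0 gradM).
have [Lam [eps [e01 H]]] := dist_le_of_same_class hd hphi kappa0 kappaK' C1 KC
  s01 sm M0 growth_cone growth_lip.
exact: (BCP_of_same_class hd hphi kappa0 kappaK' C1 KC s0 e01 H).
Qed.
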